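(* Let $d,e>1$ and $w\ge 0$ be integers. The number of $d$-balanced $e$-regular partitions in a block (any block) of $e$-weight $w$ is $$\binom{w+\left\lfloor\frac{e-1}{d}\right\rfloor-1}{w}.$$
   Context: A partition $\lambda=(\lambda_1\ge\lambda_2\ge\dots\ge\lambda_\ell>0)$ has Young diagram $[\lambda]=\{(r,c):1\le r\le \ell,\ 1\le c\le\lambda_r\}$ and size $|\lambda|=\sum\lambda_j$; $\lambda'$ denotes the conjugate partition. It is $e$-regular if no part is repeated $e$ or more times. For $(r,c)\in[\lambda]$ the arm length of the hook at $(r,c)$ is $a_{rc}(\lambda)=\lambda_r-c$ and its hook length is $h_{rc}(\lambda)=a_{rc}(\lambda)+(\lambda'_c-r)+1$. The partition $\lambda$ is $d$-balanced (with respect to $e$) if $d\mid a_{rc}(\lambda)$ for every node $(r,c)\in[\lambda]$ with $e\mid h_{rc}(\lambda)$. The $\beta$-set of $\lambda$ is $B_0(\lambda)=\{\lambda_j-j: j\ge 1\}$ (with $\lambda_j=0$ for $j>\ell$). The $e$-core of $\lambda$ is the partition whose $\beta$-set is obtained from $B_0(\lambda)$ by repeatedly replacing an element $b$ by $b-e$ whenever $b-e$ is not in the set, until this is no longer possible (equivalently, by removing rim hooks of length $e$ until none remain). The $e$-weight of $\lambda$ is $(|\lambda|-|\gamma|)/e$, where $\gamma$ is the $e$-core of $\lambda$. A block is the set of all partitions with a given $e$-core $\gamma$ (a partition equal to its own $e$-core) and a given $e$-weight $w\geq 0$. The binomial coefficient follows the usual (stars-and-bars) convention when $\lfloor (e-1)/d\rfloor=0$: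 $\binom{-1}{0}=1$ and $\binom{w-1}{w}=0$ for $w\ge1$. *)

(* Defs.v *)
From HB Require Import structures.
From Stdlib Require Import Relation_Operators.
From mathcomp Require Import all_boot all_order all_algebra.
From mathcomp Require Import classical_sets functions cardinality.

Set Implicit Arguments.
Unset Strict Implicit.
Unset Printing Implicit Defensive.


Local Open Scope nat_scope.

Definition is_partition (s : seq nat) : bool := sorted geq s && (0 \notin s).

Record intpartition := Partition {
  parts :> seq nat;
  partsP : is_partition parts
}.

HB.instance Definition _ := [isSub for parts].
HB.instance Definition _ := [Countable of intpartition by <:].

Definition psize (la : intpartition) : nat := sumn la.

(* Rows, columns and parts are indexed from 1; [part la j] is [0] when
   [j > size la], and [part la 0] is never used. *)
Definition part (la : intpartition) (j : nat) : nat := nth 0 la j.-1.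

Definition conj_part (la : intpartition) (c : nat) : nat :=
  count (fun x => c <= x) la.

Definition in_diagram (la : intpartition) (r c : nat) : bool :=
  (1 <= r <= size la) && (1 <= c <= part la r).

(* On nodes of the diagram the truncated subtractions are exact. *)
Definition arm (la : intpartition) (r c : nat) : nat := part la r - c.

Definition hook (la : intpartition) (r c : nat) : nat :=
  arm la r c + (conj_part la c - r) + 1.

Definition e_regular (e : nat) (la : intpartition) : Prop :=
  forall x, x \in parts la -> count_mem x la < e.

Definition balanced (d e : nat) (la : intpartition) : Prop :=
  forall r c, in_diagram la r c -> e %| hook la r c -> d %| arm la r c.

Local Open Scope ring_scope.
Local Open Scope classical_set_scope.

Definition beta (la : intpartition) : set int :=
  [set b | exists2 j : nat, (1 <= j)%N & b = (part la j)%:Z - j%:Z].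

Definition beta_step (e : nat) (X Y : set int) : Prop :=
  exists b : int,
    [/\ X b, ~ X (b - e%:Z) & Y = (X `\ b) `|` [set b - e%:Z]].

(* [ga] is the [e]-core of [la]: its beta-set is reached from that of [la] by
   finitely many steps, and no further step is possible. *)
Definition is_core_of (e : nat) (la ga : intpartition) : Prop :=
  clos_refl_trans (set int) (beta_step e) (beta la) (beta ga) /\
  ~ exists Y : set int, beta_step e (beta ga) Y.

(* The [e]-weight of a partition [la] whose [e]-core is [ga]. *)
Definition e_weight (e : nat) (la ga : intpartition) : rat :=
  ((psize la)%:R - (psize ga)%:R) / e%:R.

Definition block (e : nat) (ga : intpartition) (w : nat) : set intpartition :=
  [set la | is_core_of e la ga /\ e_weight e la ga = w%:R].

(* Main.v *)
Require Import Defs.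
From Stdlib Require Import Relation_Operators.
From mathcomp Require Import all_boot all_order all_algebra.
From mathcomp Require Import zify.
From mathcomp Require Import boolp classical_sets functions cardinality.
Import GRing.Theory Num.Theory.

Local Open Scope nat_scope.
Local Open Scope classical_set_scope.
Local Open Scope card_scope.

(* Put [K] beads on an abacus with [e] runners, one for each of the first [K]
   elements of the beta-set. An [e]-divisible hook is a bead lying above a gap
   of the same runner, and its arm length is the number of gaps strictly
   between the two positions; so balancedness says that a bead [b] above a gap
   [c] of its runner satisfies [gaps b = gaps c + 1] modulo [d].

   The number of solutions in a block does not depend on the core. For two
   adjacent runners, look at the rows in which exactly one of them has a bead.
   Balancedness only relates which one it is in two such rows to the number of
   gaps below these rows, and this number does not change when beads are
   exchanged within rows. At most one choice is balanced for each number of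
   beads on the right runner, and the possible numbers are symmetric; hence the
   block in which the bead counts of the two runners are exchanged has equally
   many solutions. Adding a bead at position 0 and moving all the others up by
   one rotates the runners and adds a bead to one of them. Together these moves
   allow to enlarge the bead counts at will.

   When the bead counts differ a lot, the runners do not interact: runner [j]
   can be different from the core only if [d] divides [j > 0], and then only by
   moving its [k] highest beads up by one row each. The solutions of weight [w]
   are the ways to write [w] as an ordered sum of [(e - 1) %/ d] such [k]. *)

(** * Gaps below a position, and exchanges between adjacent runners *)

Fixpoint gaps (P : nat -> bool) (x : nat) : nat :=
  if x is y.+1 then gaps P y + ~~ P y else 0.

Definition balanced_beads (d e : nat) (P : nat -> bool) : Prop :=
  forall j r s, j < e -> s < r -> P (r * e + j) -> ~~ P (s * e + j) ->
  ((gaps P (r * e + j))%:R = (gaps P (s * e + j))%:R + 1 :> 'Z_d)%R.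

(** The beads between two consecutive gaps stand for equal parts, so [e]-regularity says that no gap
    is directly followed by [e] beads. *)
Definition regular_beads (e : nat) (P : nat -> bool) : Prop :=
  forall c, ~~ P c -> exists2 y, c < y <= c + e & ~~ P y.

Lemma Zd_succ_neq (d : nat) (u : 'Z_d) : (u + 1)%R <> u.
Proof. by move/eqP; rewrite -subr_eq0 addrAC subrr add0r oner_eq0. Qed.

Lemma gapsD (P : nat -> bool) a b :
  gaps P (a + b) = gaps P a + gaps (fun y => P (a + y)) b.
Proof.
elim: b => [|b IH]; first by rewrite addn0 /= addn0.
by rewrite addnS /= IH addnA.
Qed.

(* [Q] arises from [P] by exchanging, within some rows, the entries of the
   adjacent runners [i] and [i+1]. *)
Definition same_rows (e i : nat) (P Q : nat -> bool) : Prop :=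
  (forall r j, j < e -> j != i -> j != i.+1 -> P (r * e + j) = Q (r * e + j)) /\
  (forall r, P (r * e + i) && P (r * e + i.+1) = Q (r * e + i) && Q (r * e + i.+1)
          /\ P (r * e + i) || P (r * e + i.+1) = Q (r * e + i) || Q (r * e + i.+1)).

(** Conjunction and disjunction of the two entries determine how many gaps they contain. Hence only
    the count taken between the two runners, at [i.+1], can change. *)
Lemma gaps_same_rows e i P Q r j : i.+1 < e -> same_rows e i P Q ->
  j <= e -> j != i.+1 -> gaps P (r * e + j) = gaps Q (r * e + j).
Proof.
move=> ie [H1 H2].
have W r' k : gaps P (r' * e) = gaps Q (r' * e) -> k <= e ->
  (k <= i \/ i.+1 < k) -> gaps P (r' * e + k) = gaps Q (r' * e + k).
  move=> H0; elim: k => [|k IH] ke; first by rewrite addn0.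
  case=> [ki|]; first by rewrite addnS /= IH ?H1; try lia; left; lia.
  rewrite ltnS leq_eqVlt => /orP[/eqP <-|ik].
    rewrite !addnS /=.
    have -> : gaps P (r' * e + i) = gaps Q (r' * e + i).
      have Wi : forall m, m <= i -> gaps P (r' * e + m) = gaps Q (r' * e + m).
        elim=> [|m IHm] mi; first by rewrite addn0.
        by rewrite addnS /= IHm ?H1; lia.
      exact: Wi.
    have [] := H2 r'; rewrite addnS.
    by case: (P _); case: (P _); case: (Q _); case: (Q _) => //=; lia.
  rewrite addnS /= IH ?H1; try lia; by right.
have H0 r' : gaps P (r' * e) = gaps Q (r' * e).
  elim: r' => // r' IH; rewrite mulSnr; apply: W => //; by right.
move=> je ji; apply: W => //; lia.
Qed.

(** * Labellings of the rows with a single bead *)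

Lemma sum_bool_interval (m : nat -> bool) N b : b <= N ->
  \sum_(r < N) (m r && (r < b)) = \sum_(r < b) m r.
Proof.
elim: N => [|N IH]; first by rewrite leqn0 => /eqP->; rewrite !big_ord0.
rewrite leq_eqVlt => /orP[/eqP-> | bN].
  by apply: eq_bigr => r _; rewrite ltn_ord andbT.
rewrite big_ord_recr /= IH //.
have -> : N < b = false by lia.
by rewrite andbF addn0.
Qed.

Lemma sum_bool_onto (m : nat -> bool) N v : v <= \sum_(r < N) m r ->
  exists2 x, x <= N & \sum_(r < x) m r = v.
Proof.
elim: N => [|N IH]; rewrite ?big_ord0.
  by rewrite leqn0 => /eqP->; exists 0; rewrite ?big_ord0.
rewrite big_ord_recr /= leq_eqVlt => /orP[/eqP-> | H].
  by exists N.+1; rewrite // big_ord_recr.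
have [|x xN xv] := IH; first by case: (m N) H; rewrite /=; lia.
by exists x => //; lia.
Qed.

Lemma sum_bool_le (m : nat -> bool) a b : a <= b ->
  \sum_(r < a) m r <= \sum_(r < b) m r.
Proof.
by move=> /sum_bool_interval <-; apply: leq_sum => r _; case: (m r) (r < a) => [] [].
Qed.

(* The rows [r] with [m r] have a single bead among two adjacent runners, and
   [R r] says that it lies on the right one; [G r] counts the gaps below row [r]. *)
Definition consistent_labels (d : nat) (m : nat -> bool) (G : nat -> 'Z_d)
    (R : nat -> bool) : Prop :=
  forall s r, s < r -> m s -> m r -> R r != R s -> (G r = G s + (R s)%:R)%R.

(** For rows with different labels, consistency fixes the change of [G]. Comparing all rows with the
    unlabelled row [a] and the labelled row [b] leaves two values, and the second one is never left
    once it is reached. *)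
Lemma consistent_labels_threshold (d : nat) (m : nat -> bool) (G : nat -> 'Z_d)
    (R : nat -> bool) (N : nat) a b :
  (forall r, m r -> r < N) -> consistent_labels d m G R ->
  m a -> ~~ R a -> m b -> R b ->
  exists t u, t <= N /\ forall r, m r -> G r = (u + (t <= r)%:R)%R.
Proof.
move=> mN H ma Ra mb Rb.
have up s r : s < r -> m s -> m r -> R s -> ~~ R r -> (G r = G s + 1)%R.
  by move=> sr ms mr Rs Rr; rewrite (H s r) // Rs // (negPf Rr).
have eqG s r : s < r -> m s -> m r -> ~~ R s -> R r -> G r = G s.
  by move=> sr ms mr Rs Rr; rewrite (H s r) // ?Rr (negPf Rs) // addr0.
have : exists x, m x by exists a.
case/ex_minnP=> m0 mm0 minm.
have lt0 r : m r -> r = m0 \/ m0 < r by move=> /minm; lia.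
pose u := G m0.
have [dich mono] : (forall r, m r -> G r = u \/ (G r = u + 1)%R) /\
   (forall s r, s < r -> m s -> m r -> (G s = u + 1 -> G r = u + 1)%R).
  (* If [m0] is labelled, the unlabelled rows have value [u + 1], and so have the labelled rows
     after [a], while those before [a] have value [u]. If [m0] is unlabelled, the labelled rows have
     value [u], and [b] separates the unlabelled ones. *)
  have [R0|R0] := boolP (R m0).
    have GA r : m r -> ~~ R r -> (G r = u + 1)%R.
      move=> mr Rr; case: (lt0 r mr) => [E|]; first by rewrite E R0 in Rr.
      by move=> ?; exact: up.
    split=> [r mr|s r sr ms mr Gs].
      have [Rr|Rr] := boolP (R r); last by right; exact: GA.
      have [ar|ra] := ltnP a r; first by right; rewrite (eqG a) // GA.
      left; have ra' : r < a by rewrite ltn_neqAle ra andbT; apply: contra Ra => /eqP <-.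
      by have := up _ _ ra' mr ma Rr Ra; rewrite GA // => /addIr.
    have [Rr|Rr] := boolP (R r); last exact: GA.
    have [Rs|Rs] := boolP (R s); last by rewrite (eqG s).
    have [ar|ra] := ltnP a r; first by rewrite (eqG a) // GA.
    have sa : s < a by lia.
    by have := up _ _ sa ms ma Rs Ra; rewrite GA // Gs => /esym /Zd_succ_neq.
  have GR r : m r -> R r -> G r = u.
    move=> mr Rr; case: (lt0 r mr) => [E|]; first by rewrite E (negPf R0) in Rr.
    by move=> ?; exact: eqG.
  split=> [r mr|s r sr ms mr Gs].
    have [Rr|Rr] := boolP (R r); first by left; exact: GR.
    have [br|rb] := ltnP b r; first by right; rewrite (up b) // GR.
    left; have rb' : r < b by rewrite ltn_neqAle rb andbT; apply: contra Rr => /eqP ->.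
    by rewrite -(eqG _ _ rb' mr mb Rr Rb) GR.
  have Rs : ~~ R s by apply/negP => /(GR s ms); rewrite Gs => /Zd_succ_neq.
  have [Rr|Rr] := boolP (R r); first by rewrite (eqG s).
  have [br|rb] := ltnP b r; first by rewrite (up b) // GR.
  have sb : s < b by lia.
  by have := eqG _ _ sb ms mb Rs Rb; rewrite GR // Gs => /esym /Zd_succ_neq.
(* When no mixed row has a value other than [u], [find] returns [N], a threshold beyond all mixed
   rows. *)
pose t := find (fun r => m r && (G r != u)) (iota 0 N).
have tN : t <= N by rewrite -[X in _ <= X](size_iota 0); exact: find_size.
exists t, u; split=> // r mr; have rN := mN r mr.
have [tr|rt] := leqP t r; last first.
  have := before_find 0 rt; rewrite nth_iota // add0n mr /= => /negbFE/eqP ->.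
  by rewrite addr0.
have tN' : t < N by lia.
have : has (fun r => m r && (G r != u)) (iota 0 N) by rewrite has_find size_iota.
move/(nth_find 0); rewrite -/t nth_iota // add0n => /andP[mt /eqP Gt].
have {}Gt : (G t = u + 1)%R by case: (dich t mt).
move: tr; rewrite leq_eqVlt => /orP[/eqP <- //|tr].
exact: (mono t).
Qed.

(** Unless [R] is constant on the mixed rows, the threshold shape of [G] admits consistent
    labellings with any number of labelled rows. The last clause serves regularity: a descent of [L]
    between adjacent rows is already one of [R]. *)
Lemma consistent_labels_transpose (d : nat) (m : nat -> bool) (G : nat -> 'Z_d)
    (R : nat -> bool) (N : nat) :
  (forall r, m r -> r < N) -> consistent_labels d m G R ->
  exists L, [/\ consistent_labels d m G L,
    \sum_(r < N) (m r && L r) = \sum_(r < N) (m r && ~~ R r) &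
    forall r, m r -> m r.+1 -> L r -> ~~ L r.+1 -> R r && ~~ R r.+1].
Proof.
move=> mN H.
have [[a [ma Ra]]|noA] := pselect (exists a, m a /\ ~~ R a); last first.
  have allR r : m r -> R r.
    by move=> mr; apply: contra_notT noA => Rr; exists r.
  exists (fun=> false); split=> //.
  apply: eq_bigr => r _; rewrite andbF; case: (boolP (m r)) => //= /allR -> //.
have [[b [mb Rb]]|noB] := pselect (exists b, m b /\ R b); last first.
  have allA r : m r -> ~~ R r.
    by move=> mr; apply: contra_notN noB => Rr; exists r.
  exists (fun=> true); split=> //.
  apply: eq_bigr => r _; rewrite andbT; case: (boolP (m r)) => //= /allA -> //.
(* With [t] such that [G] is [u] in the mixed rows before [t] and [u + 1] from
   [t] on, a labelling is consistent when its [true] rows are the mixed rows of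
   some [x .. t - 1], or those outside some [t .. x - 1]. *)
have [t [u [tN Gtu]]] := consistent_labels_threshold d m G R N a b mN H ma Ra mb Rb.
pose k := \sum_(r < N) (m r && ~~ R r).
have kn : k <= \sum_(r < N) m r by rewrite leq_sum // => r _; case: (m r) (R r) => [] [].
rewrite -/k.
suff [L [HL HS]] : exists L, consistent_labels d m G L /\
    \sum_(r < N) (m r && L r) = k.
  (* A descent of [L] makes [G] grow by 1 from [r] to [r.+1]. Any other pattern of [R] in these rows
     would force equal values of [G], directly or by comparing both rows with [a] or [b]. *)
  exists L; split=> // r mr mr1 Lr Lr1.
  have EL : (G r.+1 = G r + 1)%R by rewrite (HL r r.+1) // Lr // (negPf Lr1).
  have neq : G r.+1 <> G r by rewrite EL; exact: Zd_succ_neq.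
  have [Rr|Rr] := boolP (R r); have [Rr1|Rr1] := boolP (R r.+1) => //=.
  - exfalso; apply: neq.
    have [ar|ra] := ltnP a r.
      by rewrite (H a r) 1?(H a r.+1) ?(negPf Ra) ?Rr ?Rr1 //; lia.
    have ra1 : r.+1 < a.
      have : r != a by apply: contra Ra => /eqP <-.
      have : r.+1 != a by apply: contra Ra => /eqP <-.
      lia.
    by have := H r.+1 a ra1 mr1 ma; have := H r a (ltnW ra1) mr ma;
      rewrite (negPf Ra) Rr Rr1 => -> // /(_ isT) /addIr.
  - exfalso; apply: neq.
    by rewrite (H r r.+1) ?Rr1 ?(negPf Rr) // addr0.
  - exfalso; apply: neq.
    have [br|rb] := ltnP b r.
      by rewrite (H b r) 1?(H b r.+1) ?Rb ?(negPf Rr) ?(negPf Rr1) //; lia.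
    have rb1 : r.+1 < b.
      have : r != b by apply: contra Rr => /eqP ->.
      have : r.+1 != b by apply: contra Rr1 => /eqP ->.
      lia.
    by have := H r.+1 b rb1 mr1 mb; have := H r b (ltnW rb1) mr mb;
      rewrite Rb (negPf Rr) (negPf Rr1) => -> // /(_ isT) /addIr.
have ctn := sum_bool_le m t N tN.
have [kt|tk] := leqP k (\sum_(r < t) m r).
  have [|x xt xv] := sum_bool_onto m t (\sum_(r < t) m r - k); first by lia.
  exists (fun r => (x <= r < t)); split.
    move=> s r sr ms mr; rewrite (Gtu s ms) (Gtu r mr) -addrA => Lsr.
    by congr (u + _)%R; rewrite -natrD; congr (_%:R)%R; lia.
  have E : \sum_(r < N) (m r && (x <= r < t)) + \sum_(r < N) (m r && (r < x))
     = \sum_(r < N) (m r && (r < t)).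
    by rewrite -big_split; apply: eq_bigr => r _ /=; case: (m r) => //=; lia.
  rewrite !sum_bool_interval // in E; lia.
have [|y yN yv] := sum_bool_onto m N (\sum_(r < N) m r - (k - \sum_(r < t) m r)).
  by lia.
(* If [y] lies below [t], there is no mixed row from [y] to [t - 1], and [t] serves as well. *)
have [x [tx xN xv]] : exists x, [/\ t <= x, x <= N &
    \sum_(r < x) m r = \sum_(r < N) m r - (k - \sum_(r < t) m r)].
  have [ty|/ltnW yt] := leqP t y; first by exists y.
  by exists t; split=> //; have := sum_bool_le m y t yt; lia.
exists (fun r => (r < t) || (x <= r)); split.
  move=> s r sr ms mr; rewrite (Gtu s ms) (Gtu r mr) -addrA => Lsr.
  by congr (u + _)%R; rewrite -natrD; congr (_%:R)%R; lia.
have E : \sum_(r < N) (m r && ((r < t) || (x <= r))) + \sum_(r < N) (m r && (r < x))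
     = \sum_(r < N) (m r && (r < t)) + \sum_(r < N) m r.
  by rewrite -!big_split; apply: eq_bigr => r _ /=; case: (m r) => //=; lia.
rewrite !sum_bool_interval // in E; lia.
Qed.

(** * Exchanges that preserve balancedness and regularity *)

Lemma gaps_right (P : nat -> bool) x : gaps P x.+1 = gaps P x + ~~ P x.
Proof. by []. Qed.

Lemma divn_pos e r j : j < e -> (r * e + j) %/ e = r.
Proof. by move=> je; rewrite divnMDl ?divn_small ?addn0 //; lia. Qed.

Lemma modn_pos e r j : j < e -> (r * e + j) %% e = j.
Proof. by move=> je; rewrite modnMDl modn_small. Qed.

(** For two mixed rows with different labels, exactly one of the two runners has a bead above a gap.
    On runner [i] this yields an increase by 1; on runner [i.+1] the gap at [i] in the upper row
    cancels the 1, and the counts at [i] agree. *)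
Lemma balanced_beads_labels d e i P : i.+1 < e -> balanced_beads d e P ->
  consistent_labels d (fun r => P (r * e + i) != P (r * e + i.+1))
    (fun r => (gaps P (r * e + i))%:R%R) (fun r => P (r * e + i.+1)).
Proof.
move=> ie H s r sr.
have := H i r s (ltnW ie) sr; have := H i.+1 r s ie sr.
rewrite !addnS !gaps_right !natrD.
case: (P (r * e + i)) (P (r * e + i).+1) (P (s * e + i)) (P (s * e + i).+1)
  => [] [] [] [] //=; rewrite ?addr0 => H1 H2 _ _ _.
by have := H1 isT isT => /addIr.
Qed.

(** For two mixed rows the condition is the consistency of the new labels. If one of the rows is not
    mixed, both runners impose the same equation on the counts at [i], so it is inherited from
    [P]. *)
Lemma balanced_beads_same_rows d e i P Q : i.+1 < e -> balanced_beads d e P ->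
  same_rows e i P Q ->
  consistent_labels d (fun r => P (r * e + i) != P (r * e + i.+1))
    (fun r => (gaps P (r * e + i))%:R%R) (fun r => Q (r * e + i.+1)) ->
  balanced_beads d e Q.
Proof.
move=> ie H PQ HQ j r s je sr.
have gPQ k t : k < e -> k != i.+1 -> gaps Q (t * e + k) = gaps P (t * e + k).
  by move=> ke ki; rewrite (gaps_same_rows e i P Q) // ltnW.
have [ji|ji] := boolP ((j == i) || (j == i.+1)); last first.
  rewrite !gPQ //; try lia.
  by rewrite -!(proj1 PQ) //; [exact: H|lia..].
have Hi := H i r s (ltnW ie) sr; have Hi1 := H i.+1 r s ie sr.
have := HQ s r sr; rewrite /=.
have [] := (proj2 PQ) r; have [] := (proj2 PQ) s.
have gr := gPQ i r (ltnW ie) (negbT (ltn_eqF (ltnSn i))).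
have gs := gPQ i s (ltnW ie) (negbT (ltn_eqF (ltnSn i))).
case/orP: ji => /eqP ->; move: Hi Hi1; rewrite !addnS ?gaps_right gr gs ?natrD;
case: (P (r * e + i)) (P (r * e + i).+1) (P (s * e + i)) (P (s * e + i).+1)
  => [] [] [] [];
case: (Q (r * e + i)) (Q (r * e + i).+1) (Q (s * e + i)) (Q (s * e + i).+1)
  => [] [] [] [] //=; rewrite ?addr0 => H1 H2 _ _ _ _ H3 _ _;
do [exact: H1 | exact: H2 | exact: H3 | by apply: (addIr 1%R); apply: H2 | by rewrite H1
   | by rewrite H2 | by rewrite H3].
Qed.

Lemma window_bead (e : nat) (P : nat -> bool) s j :
  (forall k, j < k -> k < e -> P (s * e + k)) ->
  (forall k, k <= j -> P (s.+1 * e + k)) ->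
  forall y, s * e + j < y <= s * e + j + e -> P y.
Proof.
move=> H1 H2 y /andP[cy yc].
have [ky|ky] := ltnP y (s.+1 * e).
  by rewrite (_ : y = s * e + (y - s * e)); [apply: H1|]; lia.
by rewrite (_ : y = s.+1 * e + (y - s.+1 * e)); [apply: H2|]; lia.
Qed.

(** A gap of [Q] followed by [e] beads is traced back to such a gap of [P], in the same row and on
    the same or the adjacent exchanged runner. The hypothesis on descents is used when the gap is on
    runner [i] and both rows involved are mixed. *)
Lemma regular_beads_same_rows e i P Q : i.+1 < e -> regular_beads e P ->
  same_rows e i P Q ->
  (forall r, P (r * e + i) != P (r * e + i.+1) ->
     P (r.+1 * e + i) != P (r.+1 * e + i.+1) ->
     Q (r * e + i.+1) -> ~~ Q (r.+1 * e + i.+1) ->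
     P (r * e + i.+1) && ~~ P (r.+1 * e + i.+1)) ->
  regular_beads e Q.
Proof.
move=> ie regP [PQo PQr] adj c nQc; apply: contrapT => noQ.
have winQ y : c < y <= c + e -> Q y.
  by move=> cy; apply/negPn/negP => nQy; apply: noQ; exists y.
have bad s j : ~~ P (s * e + j) ->
  (forall k, j < k -> k < e -> P (s * e + k)) ->
  (forall k, k <= j -> P (s.+1 * e + k)) -> False.
  move=> nP H1 H2; have [y yc /negP[]] := regP _ nP.
  exact: (window_bead e P s j H1 H2).
have e0 : 0 < e by lia.
move: nQc winQ {noQ}; rewrite (divn_eq c e).
have : c %% e < e by rewrite ltn_mod.
move: (c %/ e) (c %% e) => s j {c} je nQc winQ.
have Q0 k : j < k -> k < e -> Q (s * e + k) by move=> *; apply: winQ; lia.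
have Q1 k : k <= j -> Q (s.+1 * e + k) by move=> *; apply: winQ; lia.
have full r : Q (r * e + i) -> Q (r * e + i.+1) ->
    P (r * e + i) /\ P (r * e + i.+1).
  by move=> q1 q2; have [] := PQr r; rewrite q1 q2 => /andP.
have P0 k : j < k -> k < e -> k != i -> k != i.+1 -> P (s * e + k).
  by move=> *; rewrite PQo ?Q0.
have P1 k : k <= j -> k != i -> k != i.+1 -> P (s.+1 * e + k).
  by move=> *; rewrite PQo ?Q1 //; lia.
have [/eqP ji|ji] := boolP (j == i); last have [/eqP ji1|ji1] := boolP (j == i.+1).
- subst j; have [_ E2] := PQr s; have [E1 _] := PQr s.
  have ys : Q (s * e + i.+1) by apply: Q0.
  have xs1 : Q (s.+1 * e + i) by apply: Q1.
  move: E1 E2; rewrite ys (negPf nQc) /= => E1 E2.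
  have atx : P (s * e + i.+1) -> P (s.+1 * e + i) -> False.
    move=> p1 p2; apply: (bad s i).
    + by move: E1; rewrite p1 andbT => ->.
    + move=> k ik ke; have [/eqP->//|k1] := boolP (k == i.+1); apply: P0 => //; lia.
    + move=> k ki; have [/eqP->//|k1] := boolP (k == i); apply: P1 => //; lia.
  have [ys1|ys1] := boolP (Q (s.+1 * e + i.+1)).
    have [p1 p2] := full s.+1 xs1 ys1.
    have [p3|p3] := boolP (P (s * e + i.+1)); first exact: atx.
    apply: (bad s i.+1) => // k ki.
      by move=> ke; apply: P0; lia.
    have [/eqP->//|k1] := boolP (k == i.+1); have [/eqP->//|k2] := boolP (k == i).
    by apply: P1 => //; lia.
  (* Both rows are mixed and [Q] descends, so [P] descends as well and has the same gap on runner
     [i]. *)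
  have [F1 F2] := PQr s.+1; move: F1 F2; rewrite xs1 (negPf ys1) /= => F1 F2.
  have /andP[p1 p2] : P (s * e + i.+1) && ~~ P (s.+1 * e + i.+1).
    apply: adj => //.
      by case: (P _) (P _) E1 E2 => [] [].
    by case: (P _) (P _) F1 F2 => [] [].
  by apply: atx => //; move: F2; rewrite (negPf p2) orbF.
(* Row [s.+1] is full on both runners, so a gap of [P] in row [s] is bad on either of them. *)
- subst j; have [p1 p2] := full s.+1 (Q1 i (leqnSn i)) (Q1 i.+1 (leqnn _)).
  have [E1 E2] := PQr s.
  have P1' k : k <= i.+1 -> P (s.+1 * e + k).
    have [/eqP->//|k1] := boolP (k == i.+1); have [/eqP->//|k2] := boolP (k == i).
    by move=> ki; apply: P1 => //; lia.
  have P0' k : i.+1 < k -> k < e -> P (s * e + k) by move=> *; apply: P0; lia.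
  have [p3|p3] := boolP (P (s * e + i.+1)); last exact: (bad s i.+1).
  apply: (bad s i).
  + by move: E1; rewrite p3 (negPf nQc) andbF andbT => ->.
  + by move=> k ik ke; have [/eqP->//|k1] := boolP (k == i.+1); apply: P0'; lia.
  + by move=> k ki; apply: P1'; lia.
- apply: (bad s j); first by rewrite PQo.
  + move=> k jk ke.
    have [/eqP E|k1] := boolP (k == i).
      subst k; have [-> _] // : P (s * e + i) /\ P (s * e + i.+1).
        by apply: full; apply: Q0; lia.
    have [/eqP E|k2] := boolP (k == i.+1); last exact: P0.
    subst k; have [_ ->] // : P (s * e + i) /\ P (s * e + i.+1).
      by apply: full; apply: Q0; lia.
  + move=> k kj.
    have [/eqP E|k1] := boolP (k == i).
      subst k; have [-> _] // : P (s.+1 * e + i) /\ P (s.+1 * e + i.+1).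
        by apply: full; apply: Q1; lia.
    have [/eqP E|k2] := boolP (k == i.+1); last exact: P1.
    subst k; have [_ ->] // : P (s.+1 * e + i) /\ P (s.+1 * e + i.+1).
      by apply: full; apply: Q1; lia.
Qed.

Definition relabel (e i : nat) (P L : nat -> bool) (x : nat) : bool :=
  let r := x %/ e in
  if P (r * e + i) == P (r * e + i.+1) then P x
  else if x %% e == i then ~~ L r else if x %% e == i.+1 then L r else P x.

Lemma relabelE e i P L r j : j < e -> relabel e i P L (r * e + j) =
  if P (r * e + i) == P (r * e + i.+1) then P (r * e + j)
  else if j == i then ~~ L r else if j == i.+1 then L r else P (r * e + j).
Proof. by move=> je; rewrite /relabel divn_pos ?modn_pos. Qed.

Lemma relabel_right e i P L r : i.+1 < e ->
  P (r * e + i) != P (r * e + i.+1) -> relabel e i P L (r * e + i.+1) = L r.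
Proof. by move=> ie m; rewrite relabelE // (negPf m) eqxx gtn_eqF. Qed.

Lemma relabel_same_rows e i P L : i.+1 < e -> same_rows e i P (relabel e i P L).
Proof.
move=> ie; split=> [r j je ji ji1|r].
  by rewrite relabelE // (negPf ji) (negPf ji1); case: ifP.
rewrite !relabelE ?(ltnW ie) // eqxx eqxx gtn_eqF //.
case: (L r) => /=; case: (P _) (P _) => [] [] //.
Qed.

Definition runner_count (M e : nat) (P : nat -> bool) (j : nat) : nat :=
  \sum_(r < M) P (r * e + j).

Definition runner_sum (M e : nat) (P : nat -> bool) (j : nat) : nat :=
  \sum_(r < M) r * P (r * e + j).

(** Runner [i.+1] carries the beads of the full rows and of the labelled mixed rows, runner [i]
    those of the full rows and of the unlabelled ones. Complementing the number of labels therefore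
    exchanges the two bead counts. *)
Lemma same_rows_transpose (d e i M : nat) (P : nat -> bool) : i.+1 < e ->
  (forall x, P x -> x < M * e) -> balanced_beads d e P -> regular_beads e P ->
  exists Q, [/\ same_rows e i P Q, balanced_beads d e Q, regular_beads e Q &
    runner_count M e Q i.+1 = runner_count M e P i].
Proof.
move=> ie supp balP regP.
have mM r : P (r * e + i) != P (r * e + i.+1) -> r < M.
  move=> m; rewrite ltnNge; apply/negP => Mr; move: m.
  have out k : P (r * e + k) = false.
    apply/negbTE/negP => /supp; rewrite ltnNge => /negP[].
    by apply: leq_trans (leq_mul Mr (leqnn e)) (leq_addr _ _).
  by rewrite !out.
have [L [HL HS Hadj]] := consistent_labels_transpose d _ _ _ M mM
   (balanced_beads_labels d e i P ie balP).
exists (relabel e i P L); have PQ := relabel_same_rows e i P L ie; split=> //.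
- apply: (balanced_beads_same_rows d e i P) => //.
  move=> s r sr ms mr; rewrite !relabel_right //; exact: HL.
- apply: (regular_beads_same_rows e i P) => // r mr mr1.
  rewrite !relabel_right //; exact: Hadj.
- pose both r := P (r * e + i) && P (r * e + i.+1).
  rewrite /runner_count.
  have -> : \sum_(r < M) P (r * e + i) = \sum_(r < M) both r +
     \sum_(r < M) ((P (r * e + i) != P (r * e + i.+1)) && ~~ P (r * e + i.+1)).
    rewrite -big_split; apply: eq_bigr => r _ /=; rewrite /both.
    by case: (P _) (P _) => [] [].
  rewrite -HS -big_split; apply: eq_bigr => r _ /=; rewrite relabelE // /both.
  by rewrite eqxx gtn_eqF //; case: (P _) (P _) (L r) => [] [] [].
Qed.

(** * Independence of the core *)

(** Correspondences between configurations are given as relations; choice turns them into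
    injections. *)
Lemma card_le_rel (T U : Type) (A : set T) (B : set U) (S : T -> U -> Prop) :
  (forall x, A x -> exists2 y, B y & S x y) ->
  (forall x x' y, A x -> A x' -> S x y -> S x' y -> x = x') ->
  A #<= B.
Proof.
move=> ex inj; have [[x0 Ax0]|/forallNP noA] := pselect (exists x, A x); last first.
  by have -> : A = set0 by apply/seteqP; split=> // x /noA.
have [y0 _ _] := ex x0 Ax0.
have /choice[f Hf] : forall x, exists y, A x -> B y /\ S x y.
  move=> x; have [Ax|nAx] := pselect (A x); last by exists y0 => /nAx.
  by have [y By Sxy] := ex x Ax; exists y.
have injf : {in A &, injective f}.
  move=> x x' /set_mem Ax /set_mem Ax' E.
  have [_ S1] := Hf x Ax; have [_ S2] := Hf x' Ax'.
  by apply: (inj x x' (f x)) => //; rewrite E.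
apply: (card_le_trans (B := f @` A)).
  by have := inj_card_eq injf; rewrite card_eq_le => /andP[].
by apply: subset_card_le => _ [x Ax <-]; have [] := Hf x Ax.
Qed.

Lemma card_eq_rel (T U : Type) (A : set T) (B : set U) (S : T -> U -> Prop) :
  (forall x, A x -> exists2 y, B y & S x y) ->
  (forall y, B y -> exists2 x, A x & S x y) ->
  (forall x x' y, A x -> A x' -> S x y -> S x' y -> x = x') ->
  (forall x y y', B y -> B y' -> S x y -> S x y' -> y = y') ->
  A #= B.
Proof.
move=> exB exA injA injB; rewrite card_eq_le; apply/andP; split.
  exact: (card_le_rel _ _ A B S).
by apply: (card_le_rel _ _ B A (fun y x => S x y)) => // y y' x By By' s s'; apply: (injB x).
Qed.

Lemma sum_bool_inj (M : nat) (f g : nat -> bool) :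
  (forall r, r < M -> f r -> g r) -> \sum_(r < M) f r = \sum_(r < M) g r ->
  forall r, r < M -> f r = g r.
Proof.
elim: M => // M IH fg; rewrite !big_ord_recr /= => E.
have le : \sum_(r < M) f r <= \sum_(r < M) g r.
  apply: leq_sum => r _; have := fg r (ltnW (ltn_ord r)).
  by case: (f r) (g r) => [] [] // /(_ isT).
have fgM := fg M (leqnn _).
have EM : f M = g M.
  case: (f M) (g M) E fgM => [] [] //=; rewrite ?addn0 ?addn1 => E.
    by move=> /(_ isT).
  by move: le; rewrite E ltnn.
move=> r; rewrite ltnS leq_eqVlt => /orP[/eqP->//|rM].
by apply: IH => // [k kM|]; [apply: fg; lia | apply/eqP; rewrite -(eqn_add2r (g M)) -E EM].
Qed.

Lemma eq_pos_lt (e M : nat) (P Q : nat -> bool) : 0 < e ->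
  (forall x, P x -> x < M * e) -> (forall x, Q x -> x < M * e) ->
  (forall r j, r < M -> j < e -> P (r * e + j) = Q (r * e + j)) -> P = Q.
Proof.
move=> e0 sP sQ H; apply/funext => x; have [xM|Mx] := ltnP x (M * e).
  by rewrite (divn_eq x e); apply: H; rewrite ?ltn_mod // ltn_divLR.
have -> : P x = false by apply/negbTE/negP => /sP; lia.
by apply/esym/negbTE/negP => /sQ; lia.
Qed.

(** Of the two sets of rows with a bead on runner [i.+1], one contains the other; equal cardinality
    makes them equal. This makes the exchange of adjacent runners injective. *)
Lemma same_rows_inj (d e i M : nat) (P Q : nat -> bool) : i.+1 < e ->
  (forall x, P x -> x < M * e) -> (forall x, Q x -> x < M * e) ->
  balanced_beads d e P -> balanced_beads d e Q -> same_rows e i P Q ->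
  runner_count M e P i.+1 = runner_count M e Q i.+1 -> P = Q.
Proof.
move=> ie sP sQ bP bQ PQ cPQ.
have LP := balanced_beads_labels d e i P ie bP.
have LQ := balanced_beads_labels d e i Q ie bQ.
have E1 r : r < M -> P (r * e + i.+1) = Q (r * e + i.+1).
  have mixP s : P (s * e + i.+1) != Q (s * e + i.+1) ->
      P (s * e + i) != P (s * e + i.+1) /\ Q (s * e + i) != Q (s * e + i.+1).
    by have [] := proj2 PQ s; case: (P _) (P _) (Q _) (Q _) => [] [] [] [].
  have G s : gaps Q (s * e + i) = gaps P (s * e + i).
    by rewrite (gaps_same_rows e i P Q) // ?ltn_eqF // ltnW // ltnW.
  (* Two rows in which [P] and [Q] disagree in opposite ways would give both
     [G s = G t] and [G s = G t + 1], or the same with [s] and [t] exchanged. *)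
  have opp s t : P (s * e + i.+1) -> ~~ Q (s * e + i.+1) ->
     Q (t * e + i.+1) -> ~~ P (t * e + i.+1) -> False.
    move=> Ps Qs Qt Pt.
    have [ms ms'] : P (s * e + i) != P (s * e + i.+1) /\
      Q (s * e + i) != Q (s * e + i.+1) by apply: mixP; rewrite Ps (negPf Qs).
    have [mt mt'] : P (t * e + i) != P (t * e + i.+1) /\
      Q (t * e + i) != Q (t * e + i.+1) by apply: mixP; rewrite Qt (negPf Pt).
    have [st|ts|E] := ltngtP s t.
    - have := LP s t st ms mt; have := LQ s t st ms' mt'; rewrite !G.
      rewrite Ps (negPf Qs) Qt (negPf Pt) => -> // /(_ isT).
      by rewrite addr0 => /esym /Zd_succ_neq.
    - have := LP t s ts mt ms; have := LQ t s ts mt' ms'; rewrite !G.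
      rewrite Ps (negPf Qs) Qt (negPf Pt) => -> // /(_ isT).
      by rewrite addr0 => /Zd_succ_neq.
    - by rewrite E (negPf Pt) in Ps.
  have [[s [Ps Qs]]|noS] :=
      pselect (exists s, P (s * e + i.+1) /\ ~~ Q (s * e + i.+1)).
    move=> rM; apply/esym.
    apply: (sum_bool_inj M (fun r => Q (r * e + i.+1)) (fun r => P (r * e + i.+1)))
      => // t _ Qt; apply/negPn/negP => Pt; exact: (opp s t).
  apply: (sum_bool_inj M (fun r => P (r * e + i.+1)) (fun r => Q (r * e + i.+1)))
    => // t _ Pt; apply/negPn/negP => Qt; by apply: noS; exists t.
apply: (eq_pos_lt e M) => //; first by lia.
move=> r j rM je; have [/eqP->|ji1] := boolP (j == i.+1); first exact: E1.
have [/eqP->|ji] := boolP (j == i); last by rewrite (proj1 PQ).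
have [] := proj2 PQ r; rewrite E1 //.
by case: (P _) (Q _) (Q _) => [] [] [].
Qed.

(* The block of weight [w] whose runners carry [n_0, ..., n_(e-1)] beads: its
   core has beads in the rows [0 .. n_j - 1] of runner [j], whose row numbers
   sum to ['C(n_j, 2)], and moving a bead up by one row adds 1 to the weight. *)
Definition bead_block (d e M w : nat) (n : seq nat) : set (nat -> bool) :=
  [set P : nat -> bool | [/\ forall x, P x -> x < M * e,
    forall j, j < e -> runner_count M e P j = nth 0 n j,
    \sum_(j < e) runner_sum M e P j = w + \sum_(a <- n) 'C(a, 2),
    balanced_beads d e P & regular_beads e P]].

Lemma same_rows_supp (e i M : nat) (P Q : nat -> bool) : i.+1 < e ->
  same_rows e i P Q -> (forall x, P x -> x < M * e) -> forall x, Q x -> x < M * e.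
Proof.
move=> ie [PQ1 PQ2] sP x Qx; rewrite ltnNge; apply/negP => Mx.
have Mr : M <= x %/ e by rewrite leq_divRL //; lia.
have out k : k < e -> P (x %/ e * e + k) = false.
  move=> ke; apply/negbTE/negP => /sP; rewrite ltnNge => /negP[].
  by apply: leq_trans (leq_mul Mr (leqnn e)) (leq_addr _ _).
move: Qx; rewrite (divn_eq x e); set r := x %/ e.
have : x %% e < e by rewrite ltn_mod; lia.
move: (x %% e) => j je Qj.
have [] := PQ2 r; rewrite !out //; last by lia.
have [/eqP E|ji] := boolP (j == i); first by rewrite -E Qj.
have [/eqP E|ji1] := boolP (j == i.+1); first by rewrite -E Qj orbT.
by move: Qj; rewrite -PQ1 // out.
Qed.

Lemma bead_block_swap_le (d e M w : nat) (s1 s2 : seq nat) a b :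
  e = size (s1 ++ a :: b :: s2) ->
  bead_block d e M w (s1 ++ a :: b :: s2) #<= bead_block d e M w (s1 ++ b :: a :: s2).
Proof.
move=> eE; set i := size s1.
have ie : i.+1 < e by rewrite eE size_cat /= -/i; lia.
have ie' := ltnW ie.
apply: (card_le_rel _ _ _ _ (same_rows e i)) => [P|P P' Q].
  move=> [sP cP wP bP rP].
  have [Q [PQ bQ rQ cQ]] := same_rows_transpose d e i M P ie sP bP rP.
  exists Q => //.
  (* With [f] constant 1 this preserves the total bead count of the two runners, with [f] the
     identity their total row sum, hence the weight. *)
  have cD (f : nat -> nat) : (forall r, f r * Q (r * e + i) + f r * Q (r * e + i.+1) =
     f r * P (r * e + i) + f r * P (r * e + i.+1)).
    move=> r; have [] := proj2 PQ r.
    by case: (P _) (P _) (Q _) (Q _) => [] [] [] [] //=; lia.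
  have cQ' : runner_count M e Q i = runner_count M e P i.+1.
    have : runner_count M e Q i + runner_count M e Q i.+1 =
       runner_count M e P i + runner_count M e P i.+1.
      rewrite -!big_split; apply: eq_bigr => r _ /=.
      by have := cD (fun=> 1) r; rewrite !mul1n.
    lia.
  split=> //; first exact: (same_rows_supp e i M P).
  - move=> j je; have := cP i ie'; have := cP i.+1 ie; have := cP j je.
    have iSi : (i.+1 < i) = false by lia.
    rewrite !nth_cat -/i !ltnn iSi subnn subSnn /= => cj ci1 ci.
    have [/eqP->|ji] := boolP (j == i); first by rewrite ltnn subnn /= cQ' ci1.
    have [/eqP->|ji1] := boolP (j == i.+1).
      by rewrite iSi subSnn /= cQ ci.
    have -> : runner_count M e Q j = runner_count M e P j.
      by apply: eq_bigr => r _; rewrite (proj1 PQ).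
    rewrite cj; case: ltnP => // ij.
    by have [k ->] : exists k, j - i = k.+2 by exists (j - i).-2; lia.
  - have -> : \sum_(c <- s1 ++ b :: a :: s2) 'C(c, 2) =
        \sum_(c <- s1 ++ a :: b :: s2) 'C(c, 2).
      by rewrite !big_cat !big_cons /=; lia.
    rewrite -wP.
    rewrite (bigD1 (Ordinal ie)) // (bigD1 (Ordinal ie')) /=; last first.
      by apply/eqP => /(congr1 val) /=; lia.
    rewrite [RHS](bigD1 (Ordinal ie)) // (bigD1 (Ordinal ie')) /=; last first.
      by apply/eqP => /(congr1 val) /=; lia.
    rewrite !addnA; congr (_ + _).
      rewrite addnC [RHS]addnC -!big_split; apply: eq_bigr => r _ /=.
      exact: (cD id).
    apply: eq_bigr => j /andP[j1 j2]; apply: eq_bigr => r _.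
    by rewrite (proj1 PQ).
move=> [sP cP wP bP rP] [sP' cP' wP' bP' rP'] PQ P'Q.
apply: (same_rows_inj d e i M) => //; last by rewrite cP ?cP'.
have [H1 H2] := PQ; have [H1' H2'] := P'Q.
split=> [r j je ji ji1|r]; first by rewrite H1 ?H1'.
by have [-> ->] := H2 r; have [-> ->] := H2' r.
Qed.

(** Adjacent exchanges generate all permutations: [move_front] brings the required entry forward,
    and the prefix [p] holds the entries already in place. *)
Lemma bead_block_perm (d M w : nat) (s t : seq nat) : perm_eq s t ->
  bead_block d (size s) M w s #= bead_block d (size s) M w t.
Proof.
have swap s1 s2 a b :
  bead_block d (size (s1 ++ a :: b :: s2)) M w (s1 ++ a :: b :: s2) #=
  bead_block d (size (s1 ++ a :: b :: s2)) M w (s1 ++ b :: a :: s2).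
  rewrite card_eq_le; apply/andP; split; apply: bead_block_swap_le => //.
  by rewrite !size_cat.
have move_front s1 s2 a :
  bead_block d (size (s1 ++ a :: s2)) M w (s1 ++ a :: s2) #=
  bead_block d (size (s1 ++ a :: s2)) M w (a :: s1 ++ s2).
  elim/last_ind: s1 s2 => [|s1 b IH] s2; first exact: card_eqxx.
  rewrite !cat_rcons; apply: card_eq_trans (swap s1 s2 b a) _.
  by have := IH (b :: s2); rewrite !size_cat.
have H p : forall s t, perm_eq s t ->
    bead_block d (size (p ++ s)) M w (p ++ s) #= bead_block d (size (p ++ s)) M w (p ++ t).
  move=> {}s; elim: s p => [|a s IH] p {}t.
    by rewrite perm_sym => /perm_nilP ->; exact: card_eqxx.
  move=> pst; have : a \in t by rewrite -(perm_mem pst) mem_head.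
  move/splitPr => tE; case: tE pst => t1 t2.
  rewrite -[t1 ++ _]/(t1 ++ [:: a] ++ t2) perm_sym perm_catCA perm_cons perm_sym => pst.
  have H1 := IH (rcons p a) _ pst; rewrite !cat_rcons in H1.
  apply: card_eq_trans H1 _.
  have E : size (p ++ a :: s) = size (p ++ a :: t1 ++ t2).
    by rewrite !size_cat /= (perm_size pst) size_cat.
  rewrite E card_eq_sym.
  have M1 := move_front (p ++ t1) t2 a.
  have M2 := move_front p (t1 ++ t2) a.
  rewrite -!catA /= in M1 M2.
  have E2 : size (p ++ t1 ++ a :: t2) = size (p ++ a :: t1 ++ t2).
    by rewrite !size_cat /= !size_cat /=; lia.
  rewrite E2 in M1; apply: card_eq_trans M1 _.
  by rewrite card_eq_sym.
by move=> pst; exact: (H [::]).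
Qed.

(** * Rotating the runners and enlarging the bead counts *)

Lemma balanced_beadsP (d e : nat) (P : nat -> bool) : 0 < e ->
  balanced_beads d e P <-> forall b c, c < b -> b = c %[mod e] -> P b -> ~~ P c ->
    ((gaps P b)%:R = (gaps P c)%:R + 1 :> 'Z_d)%R.
Proof.
move=> e0; split=> [H b c cb bc Pb Pc|H j r s je sr Pr Ps].
  rewrite (divn_eq b e) (divn_eq c e) -bc; apply: H; rewrite ?ltn_mod //.
  - have [//|bc'] := ltnP (c %/ e) (b %/ e).
    have := leq_mul bc' (leqnn e); have := divn_eq b e; have := divn_eq c e; rewrite bc; lia.
  - by rewrite -divn_eq.
  - by rewrite bc -divn_eq.
apply: H; rewrite ?modnMDl //; have : s.+1 * e <= r * e by rewrite leq_mul2r sr orbT.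
rewrite mulSn; lia.
Qed.

(** Distinct row numbers have the least sum when they are the initial ones. *)
Lemma sum_rows_ge (M : nat) (f : nat -> bool) :
  'C(\sum_(r < M) f r, 2) <= \sum_(r < M) r * f r.
Proof.
elim: M => [|M IH]; first by rewrite !big_ord0.
rewrite !big_ord_recr /=; case: (f M); last by rewrite muln0 !addn0.
have : \sum_(r < M) f r <= M.
  rewrite -[X in _ <= X]card_ord -sum1_card; apply: leq_sum => r _; by case: (f r).
by rewrite addn1 binS bin1 muln1 => ?; apply: leq_add.
Qed.

Lemma sum_D1_bool (M r0 : nat) (f : nat -> bool) (g : nat -> nat) : r0 < M ->
  \sum_(r < M) g r * f r =
  g r0 * f r0 + \sum_(r < M) g r * (f r && (val r != r0)).
Proof.
move=> r0M; rewrite (bigD1 (Ordinal r0M)) //= [in RHS](bigD1 (Ordinal r0M)) //=.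
rewrite eqxx andbF muln0 add0n; congr (_ + _); apply: eq_bigr => r rr0.
by rewrite (_ : (val r != r0) = true) ?andbT.
Qed.

(** The bound of [sum_rows_ge] is applied to the beads other than the one in row [r0]. *)
Lemma sum_rows_bead (M r0 : nat) (f : nat -> bool) : r0 < M -> f r0 ->
  'C(\sum_(r < M) f r, 2) + r0 < \sum_(r < M) r * f r + \sum_(r < M) f r.
Proof.
move=> r0M fr0; have := sum_rows_ge M (fun r => f r && (r != r0)).
have := sum_D1_bool M r0 f id r0M; have := sum_D1_bool M r0 f (fun=> 1) r0M.
rewrite /= fr0 muln1; under eq_bigr do rewrite mul1n.
under [in X in _ = _ + X]eq_bigr do rewrite mul1n.
move=> -> ->; rewrite add1n binS bin1.
by move: (bigop _ _ _) (bigop _ _ _) ('C(_, _)) => *; lia.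
Qed.

(** The bound of [sum_rows_ge] is applied after filling the gap in row [r0]. *)
Lemma sum_rows_gap (M r0 : nat) (f : nat -> bool) : r0 < M -> ~~ f r0 ->
  'C(\sum_(r < M) f r, 2) + \sum_(r < M) f r <= \sum_(r < M) r * f r + r0.
Proof.
move=> r0M fr0; pose h r := f r || (r == r0).
have E r : (h r && (r != r0)) = f r.
  by rewrite /h; have [->|] := eqVneq r r0; rewrite ?orbF ?andbT ?andbF ?(negPf fr0).
have hr0 : h r0 by rewrite /h eqxx orbT.
have := sum_rows_ge M h.
have := sum_D1_bool M r0 h id r0M; have := sum_D1_bool M r0 h (fun=> 1) r0M.
rewrite /= hr0 muln1; under eq_bigr do rewrite mul1n.
under [in X in _ = _ + X]eq_bigr do rewrite mul1n E.
under [in X in _ -> _ = _ + X -> _]eq_bigr do rewrite E.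
move=> -> ->; rewrite add1n binS bin1.
by move: (bigop _ _ _) (bigop _ _ _) ('C(_, _)) => *; lia.
Qed.

(** No runner has a row sum below its value in the core, so none can exceed that value by more than
    the total excess [w]. *)
Lemma bead_block_runner (d e M w : nat) (n : seq nat) P j :
  e = size n -> bead_block d e M w n P -> j < e ->
  runner_sum M e P j <= w + 'C(nth 0 n j, 2).
Proof.
move=> en [_ cP wP _ _] je; move: wP.
rewrite (big_nth 0) -en big_mkord (bigD1 (Ordinal je)) //=.
rewrite [X in w + X](bigD1 (Ordinal je)) //=.
have : \sum_(i < e | i != Ordinal je) 'C(nth 0 n i, 2)
   <= \sum_(i < e | i != Ordinal je) runner_sum M e P i.
  apply: leq_sum => i _; rewrite -cP //; exact: (sum_rows_ge M (fun r => P (r * e + i))).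
move: (\sum_(i < e | i != Ordinal je) _) (\sum_(i < e | i != Ordinal je) _) => x y xy E.
by rewrite -(leq_add2r x) E -addnA leq_add2l leq_add2l.
Qed.

Lemma bead_block_bead (d e M w : nat) (n : seq nat) P r j :
  e = size n -> bead_block d e M w n P -> j < e -> P (r * e + j) ->
  r < nth 0 n j + w.
Proof.
move=> en BP je Prj; have := bead_block_runner d e M w n P j en BP je.
have [sP cP _ _ _] := BP; rewrite -cP //.
have rM : r < M.
  rewrite ltnNge; apply/negP => Mr; have := sP _ Prj; rewrite ltnNge => /negP[].
  exact: leq_trans (leq_mul Mr (leqnn e)) (leq_addr _ _).
have := sum_rows_bead M r (fun r => P (r * e + j)) rM Prj.
rewrite /runner_count /runner_sum; lia.
Qed.

Lemma bead_block_gap (d e M w : nat) (n : seq nat) P r j :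
  e = size n -> bead_block d e M w n P -> j < e -> ~~ P (r * e + j) ->
  nth 0 n j <= r + w.
Proof.
move=> en BP je Prj; have := bead_block_runner d e M w n P j en BP je.
have [sP cP _ _ _] := BP; rewrite -cP //.
have [rM|Mr] := ltnP r M.
  have := sum_rows_gap M r (fun r => P (r * e + j)) rM Prj.
  rewrite /runner_count /runner_sum; lia.
have : runner_count M e P j <= M.
  rewrite -[X in _ <= X]card_ord -sum1_card; apply: leq_sum => i _; by case: (P _).
lia.
Qed.

(** A bead in position 0 adds no gap and has nothing below it; the shift keeps congruences modulo
    [e], although it changes rows and runners. *)
Lemma shift_balanced (d e : nat) (P Q : nat -> bool) : 0 < e -> Q 0 ->
  (forall x, Q x.+1 = P x) -> balanced_beads d e Q <-> balanced_beads d e P.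
Proof.
move=> e0 Q0 QP.
have gQ x : gaps Q x.+1 = gaps P x.
  elim: x => [|x IH]; first by rewrite /= Q0.
  by rewrite -[LHS]/(gaps Q x.+1 + ~~ Q x.+1) IH QP.
rewrite !balanced_beadsP //; split=> H b c.
  move=> cb bc Pb Pc; rewrite -!gQ; apply: H; rewrite ?QP //.
  by rewrite -addn1 -[c.+1]addn1; apply/eqP; rewrite eqn_modDr; apply/eqP.
case: c => [|c]; first by rewrite Q0.
case: b => [|b] //; rewrite !gQ !QP ltnS => cb bc; apply: H => //.
by apply/eqP; rewrite -(eqn_modDr 1) !addn1; apply/eqP.
Qed.

Lemma shift_regular (e : nat) (P Q : nat -> bool) : Q 0 ->
  (forall x, Q x.+1 = P x) -> regular_beads e Q <-> regular_beads e P.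
Proof.
move=> Q0 QP; split=> H c.
  rewrite -QP => /H[[|y] cy Qy]; first by rewrite Q0 in Qy.
  by exists y; rewrite -?QP //; lia.
case: c => [|c]; rewrite ?Q0 // QP => /H[y cy Py].
by exists y.+1; rewrite ?QP //; lia.
Qed.

(** The last runner becomes the first, moves up by one row and gets the new bead in row 0. The
    hypothesis on the last position ensures that no bead leaves the first [M.+1] rows. *)
Lemma shift_runners (e M : nat) (P Q : nat -> bool) : Q 0 ->
  (forall x, Q x.+1 = P x) -> ~~ P (M * e.+1 + e) ->
  runner_count M.+1 e.+1 Q 0 = (runner_count M.+1 e.+1 P e).+1 /\
  runner_sum M.+1 e.+1 Q 0 = runner_sum M.+1 e.+1 P e + runner_count M.+1 e.+1 P e.
Proof.
move=> Q0 QP last.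
have E r : Q (r.+1 * e.+1 + 0) = P (r * e.+1 + e) by rewrite -QP; congr Q; lia.
rewrite /runner_count /runner_sum; split.
  rewrite big_ord_recl /= Q0 [in RHS]big_ord_recr /= (negPf last) addn0 add1n.
  by congr _.+1; apply: eq_bigr => r _; rewrite E.
rewrite big_ord_recl mul0n add0n ![in RHS]big_ord_recr /= (negPf last) muln0 !addn0.
by rewrite -big_split; apply: eq_bigr => r _; rewrite E mulSn addnC.
Qed.

(** The row sum grows by the bead count [a] of the last runner, which is also the growth from
    ['C(a, 2)] to ['C(a.+1, 2)]; so the weight stays the same. *)
Lemma shift_bead_block (d M w : nat) (s : seq nat) a (P Q : nat -> bool) : Q 0 ->
  (forall x, Q x.+1 = P x) -> ~~ P (M * (size s).+1 + size s) ->
  bead_block d (size s).+1 M.+1 w (rcons s a) P <->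
  bead_block d (size s).+1 M.+1 w (a.+1 :: s) Q.
Proof.
set m := size s; move=> Q0 QP last.
have [cQ sQ] := shift_runners m M P Q Q0 QP last.
have cQS j : runner_count M.+1 m.+1 Q j.+1 = runner_count M.+1 m.+1 P j.
  by apply: eq_bigr => r _; rewrite -QP addnS.
have sQS j : runner_sum M.+1 m.+1 Q j.+1 = runner_sum M.+1 m.+1 P j.
  by apply: eq_bigr => r _; rewrite -QP addnS.
have supp : (forall x, P x -> x < M.+1 * m.+1) <-> (forall x, Q x -> x < M.+1 * m.+1).
  split=> H [|x]; rewrite ?QP //; last by rewrite -QP => /H; lia.
  move=> Px; have := H x Px; rewrite mulSn.
  suff : x != M * m.+1 + m by lia.
  by apply: contra last => /eqP <-.
have wE : \sum_(j < m.+1) runner_sum M.+1 m.+1 Q j =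
   \sum_(j < m.+1) runner_sum M.+1 m.+1 P j + runner_count M.+1 m.+1 P m.
  rewrite big_ord_recl sQ [in RHS]big_ord_recr /= addnC addnA; congr (_ + _ + _).
  by apply: eq_bigr => j _; rewrite -sQS.
have binE : \sum_(b <- a.+1 :: s) 'C(b, 2) = \sum_(b <- rcons s a) 'C(b, 2) + a.
  by rewrite -cats1 big_cat big_seq1 big_cons binS bin1 addnC addnA.
split=> -[sP cP wP bP rP]; split.
- exact/supp.
- case=> [|j] je; rewrite ?cQ ?cQS cP //= ?nth_rcons ?ltnn ?eqxx //; last by lia.
  by rewrite -ltnS je.
- by rewrite wE binE wP cP // nth_rcons ltnn eqxx addnA.
- exact/(shift_balanced d m.+1 P Q).
- exact/(shift_regular m.+1 P Q).
- exact/supp.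
- move=> j je; rewrite nth_rcons; case: ltnP => [jm|mj].
    by rewrite -cQS cP.
  have -> : j = m by lia.
  by rewrite eqxx; apply: succn_inj; rewrite -cQ cP.
- have cm : runner_count M.+1 m.+1 P m = a by apply: succn_inj; rewrite -cQ cP.
  by apply/eqP; rewrite -(eqn_add2r a) -{1}cm -wE wP binE addnA.
- exact/(shift_balanced d m.+1 P Q).
- exact/(shift_regular m.+1 P Q).
Qed.

(** The bound [a + w < M] keeps the last position empty, and [w <= a] forces a bead in position 0 of
    every configuration on the right, so that the shift can be undone. *)
Lemma bead_block_shift (d M w : nat) (s : seq nat) a : w <= a -> a + w < M ->
  bead_block d (size s).+1 M w (rcons s a) #= bead_block d (size s).+1 M w (a.+1 :: s).
Proof.
case: M => // M wa aM; set m := size s.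
apply: (card_eq_rel _ _ _ _ (fun P Q : nat -> bool => Q 0 /\ forall x, Q x.+1 = P x)).
- move=> P BP; exists (fun x => if x is y.+1 then P y else true) => //.
  apply/(shift_bead_block _ _ _ _ _ P) => //.
  apply/negP => /(bead_block_bead _ _ _ _ _ _ _ _ _ BP).
  rewrite size_rcons nth_rcons ltnn eqxx => /(_ erefl (ltnSn _)); lia.
- move=> Q BQ.
  have Q0 : Q 0.
    apply/negPn/negP => nQ0.
    have := bead_block_gap d m.+1 M.+1 w (a.+1 :: s) Q 0 0 erefl BQ isT nQ0; rewrite /=; lia.
  exists (fun x => Q x.+1) => //.
  apply/(shift_bead_block _ _ _ _ _ _ Q) => //.
  by have [sQ _ _ _ _] := BQ; apply/negP => /sQ; rewrite -/m mulSn; lia.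
- by move=> P P' Q _ _ [_ H] [_ H']; apply/funext => x; rewrite -H H'.
- move=> P Q Q' _ _ [Q0 H] [Q'0 H']; apply/funext => -[|x]; first by rewrite Q0 Q'0.
  by rewrite H H'.
Qed.

Lemma bead_block_incr (d M w : nat) (s1 s2 : seq nat) a : w <= a -> a + w < M ->
  bead_block d (size (s1 ++ a :: s2)) M w (s1 ++ a :: s2) #=
  bead_block d (size (s1 ++ a :: s2)) M w (s1 ++ a.+1 :: s2).
Proof.
move=> wa aM.
have p1 : perm_eq (s1 ++ a :: s2) (rcons (s1 ++ s2) a).
  by rewrite perm_sym perm_rcons -cat1s -[a :: s2]cat1s perm_catCA.
have p2 : perm_eq (a.+1 :: s1 ++ s2) (s1 ++ a.+1 :: s2).
  by rewrite -cat1s -[a.+1 :: s2]cat1s perm_catCA.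
have E1 : size (s1 ++ a :: s2) = (size (s1 ++ s2)).+1 by rewrite !size_cat /=; lia.
apply: card_eq_trans (bead_block_perm _ _ _ _ _ p1) _.
rewrite E1; apply: card_eq_trans (bead_block_shift _ _ _ _ _ wa aM) _.
exact: (bead_block_perm _ _ _ _ _ p2).
Qed.

Lemma bead_block_raise (d M w : nat) (n t : seq nat) : size n = size t ->
  (forall j, j < size n -> w <= nth 0 n j) ->
  (forall j, j < size n -> nth 0 n j <= nth 0 t j) ->
  (forall j, j < size n -> nth 0 t j + w < M) ->
  bead_block d (size n) M w n #= bead_block d (size n) M w t.
Proof.
suff H p : size n = size t ->
    (forall j, j < size n -> w <= nth 0 n j) ->
    (forall j, j < size n -> nth 0 n j <= nth 0 t j) ->
    (forall j, j < size n -> nth 0 t j + w < M) ->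
  bead_block d (size (p ++ n)) M w (p ++ n) #= bead_block d (size (p ++ n)) M w (p ++ t).
  exact: (H [::]).
elim: n t p => [|a n IH] [|b t] p; [by move=> *; exact: card_eqxx|by []|by []|].
move=> [st] Hw Hle HM.
have wa := Hw 0 isT; have ab := Hle 0 isT; have bM := HM 0 isT; rewrite /= in wa ab bM.
have H1 : bead_block d (size (p ++ a :: n)) M w (p ++ a :: n) #=
    bead_block d (size (p ++ a :: n)) M w (p ++ b :: n).
  rewrite -(subnKC ab); move: (b - a) (subnKC ab) => k abk.
  have : a + k + w < M by rewrite abk.
  elim: k {abk} => [|k IHk] kM; first by rewrite addn0; exact: card_eqxx.
  apply: card_eq_trans (IHk _) _; first by lia.
  have -> : size (p ++ a :: n) = size (p ++ (a + k) :: n) by rewrite !size_cat.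
  by rewrite addnS; apply: bead_block_incr; lia.
apply: card_eq_trans H1 _.
have -> : size (p ++ a :: n) = size (rcons p b ++ n) by rewrite cat_rcons !size_cat.
rewrite -!cat_rcons; apply: IH => // j jn;
  [exact: (Hw j.+1)|exact: (Hle j.+1)|exact: (HM j.+1)].
Qed.

(** * Blocks with separated runners *)

Lemma gaps_window (P : nat -> bool) x y : x <= y ->
  (forall z, x <= z < y -> P z) -> gaps P y = gaps P x.
Proof.
elim: y => [|y IH]; first by rewrite leqn0 => /eqP->.
rewrite leq_eqVlt => /orP[/eqP-> //|xy] H /=.
by rewrite IH ?H ?addn0 //; [lia|move=> z zxy; apply: H; lia].
Qed.

Lemma gaps_empty_window (P : nat -> bool) x y : x <= y ->
  (forall z, x <= z < y -> ~~ P z) -> gaps P y = gaps P x + (y - x).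
Proof.
elim: y => [|y IH]; first by rewrite leqn0 => /eqP-> _; rewrite addn0.
rewrite leq_eqVlt => /orP[/eqP-> //|xy] H /=; first by rewrite subnn addn0.
rewrite IH ?H //; [lia|lia|move=> z zxy; apply: H; lia].
Qed.

Lemma Zd_nat_eq0 (d j : nat) : 1 < d -> (j%:R == 0 :> 'Z_d)%R = (d %| j).
Proof. by move=> hd; rewrite -val_eqE /= val_Zp_nat. Qed.

(* The runners are so far apart that, in the rows where runner [j] is neither
   full nor empty, the runners on its left are empty and those on its right full. *)
Definition separated (e w : nat) (nn : nat -> nat) (P : nat -> bool) : Prop :=
  (forall i j, i < j -> nn i + (2 * w + 2) <= nn j) /\
  (forall j, j < e -> (forall r, P (r * e + j) -> r < nn j + w) /\
     (forall r, ~~ P (r * e + j) -> nn j <= r + w)).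

(** A gap of a runner [k > j] in row [r] would give [nn k <= r + w < nn j + 2 * w], and a bead of a
    runner [k < j] in row [r.+1] would give [nn j <= r + w < nn k + 2 * w]; the spacing excludes
    both. *)
Lemma separated_row (e w : nat) nn P j r k : separated e w nn P -> j < e -> k < e ->
  nn j <= r + w -> r < nn j + w ->
  (j < k -> P (r * e + k)) /\ (k < j -> ~~ P (r.+1 * e + k)).
Proof.
move=> [sp H] je ke r1 r2; have [Hb Hg] := H k ke; split=> [jk|kj].
  by apply/negPn/negP => /Hg; have := sp j k jk; lia.
by apply/negP => /Hb; have := sp k j kj; lia.
Qed.

(** From one row to the next on runner [j], one first crosses full runners on the right and then [j]
    empty ones on the left. *)
Lemma separated_gapsS (e w : nat) nn P j r : separated e w nn P -> j < e ->
  nn j <= r + w -> r < nn j + w ->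
  gaps P (r.+1 * e + j) = gaps P (r * e + j) + ~~ P (r * e + j) + j.
Proof.
move=> sep je r1 r2.
have H k ke := separated_row e w nn P j r k sep je ke r1 r2.
have re1 : r.+1 * e = r * e + e by rewrite mulSnr.
have W1 : gaps P (r.+1 * e) = gaps P (r * e + j).+1.
  apply: gaps_window; first by lia.
  move=> z zr; have -> : z = r * e + (z - r * e) by lia.
  by apply: (proj1 (H _ _)); lia.
have W2 : gaps P (r.+1 * e + j) = gaps P (r.+1 * e) + (r.+1 * e + j - r.+1 * e).
  apply: gaps_empty_window; first by rewrite leq_addr.
  move=> z zr; have -> : z = r.+1 * e + (z - r.+1 * e) by lia.
  by apply: (proj2 (H _ _)); lia.
by rewrite W2 W1 addKn gaps_right.
Qed.

Lemma separated_gaps (e w : nat) nn P j s r : separated e w nn P -> j < e ->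
  nn j <= s + w -> r <= nn j + w -> s <= r ->
  (forall t, s <= t < r -> P (t * e + j)) ->
  gaps P (r * e + j) = gaps P (s * e + j) + (r - s) * j.
Proof.
move=> sep je s1; elim: r => [|r IH] r1.
  by rewrite leqn0 => /eqP -> _; rewrite subnn addn0.
rewrite leq_eqVlt => /orP[/eqP -> _|sr H]; first by rewrite subnn addn0.
have Pr : P (r * e + j) by apply: H; lia.
have IHr : gaps P (r * e + j) = gaps P (s * e + j) + (r - s) * j.
  by apply: IH => //; [lia|move=> t tr; apply: H; lia].
have -> := separated_gapsS e w nn P j r sep je; [|lia|lia].
by rewrite Pr IHr subSn // mulSn; lia.
Qed.

(** Some gap has a bead directly above it, one row up; there the count grows by [j + 1], so
    balancedness makes [d] divide [j]. On runner 0 that gap would be followed by [e] beads, against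
    regularity. *)
Lemma separated_gap_bead (d e w : nat) nn P j s r : 1 < d -> 1 < e ->
  separated e w nn P ->
  balanced_beads d e P -> regular_beads e P -> j < e ->
  s < r -> ~~ P (s * e + j) -> P (r * e + j) -> (d %| j) && (0 < j).
Proof.
move=> hd he sep bP rP je sr Ps Pr.
have [t [st tr Pt Pt1]] : exists t, [/\ s <= t, t < r, ~~ P (t * e + j) & P (t.+1 * e + j)].
  elim: r sr Pr => // r IH; rewrite ltnS leq_eqVlt => /orP[/eqP <-|sr] Pr.
    by exists s.
  have [Pr'|Pr'] := boolP (P (r * e + j)); last by exists r; split=> //; apply: ltnW.
  by have [t [*]] := IH sr Pr'; exists t; split=> //; lia.
have [Hb Hg] := proj2 sep j je.
have t1 := Hg t Pt; have t2 := Hb _ Pt1.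
have := bP j t.+1 t je (ltnSn t) Pt1 Pt.
rewrite (separated_gapsS e w nn) //; last by lia.
rewrite Pt !natrD addrC -[RHS]add0r => /addIr /eqP; rewrite Zd_nat_eq0 // => -> /=.
rewrite lt0n; apply/negP => /eqP j0; subst j.
have [y yc /negP[]] := rP _ Pt; apply: (window_bead e P t 0) yc => [k k0 ke|k].
  by have [] := separated_row e w nn P 0 t k sep je ke t1; [lia|move=> H _; apply: H].
by rewrite leqn0 => /eqP ->.
Qed.

(** Compared with the bead in row [r], any two gaps below it have equal counts modulo [d]. But from
    a gap to the next one on the runner the count grows by 1 plus a multiple of [j], and [d] divides
    [j]. *)
Lemma separated_gap_gap_bead (d e w : nat) nn P j s1 s2 r : 1 < d -> 1 < e ->
  separated e w nn P ->
  balanced_beads d e P -> regular_beads e P -> j < e ->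
  s1 < s2 -> s2 < r -> ~~ P (s1 * e + j) -> ~~ P (s2 * e + j) -> ~~ P (r * e + j).
Proof.
move=> hd he sep bP rP je s12 s2r P1 P2; apply/negP => Pr.
have /andP[dj _] := separated_gap_bead d e w nn P j s2 r hd he sep bP rP je s2r P2 Pr.
have [s [ss s's Ps Pb]] : exists s, [/\ s1 <= s, s < s2, ~~ P (s * e + j) &
    forall t, s < t < s2 -> P (t * e + j)].
  elim: s2 s12 {s2r P2} => // s2 IH; rewrite ltnS leq_eqVlt => /orP[/eqP E|s12].
    by exists s1; split=> //; [lia|move=> t; lia].
  have [P2|P2] := boolP (P (s2 * e + j)); last first.
    by exists s2; split=> //; [apply: ltnW|move=> t; lia].
  have [s [ss s's Ps Pb]] := IH s12; exists s; split=> //; first by lia.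
  move=> t; have [/eqP -> //|ts2 tt] := boolP (t == s2); apply: Pb; lia.
have [Hb Hg] := proj2 sep j je.
have l1 := Hg _ Ps; have l2 := Hb _ Pr.
have sr := ltn_trans s's s2r.
have := bP j r s2 je s2r Pr P2; rewrite (bP j r s je sr Pr Ps) => /addIr.
rewrite (separated_gaps e w nn P j s.+1 s2) //; try lia.
rewrite (separated_gapsS e w nn) //; try lia.
rewrite Ps !natrD natrM; have /eqP -> : (j%:R == 0 :> 'Z_d)%R by rewrite Zd_nat_eq0.
by rewrite mulr0 !addr0 => /esym /Zd_succ_neq.
Qed.

(* [k] successive beads at the top of a full runner, each moved up by one row. *)
Definition raised (n k r : nat) : bool := (r <= n) && (r + k != n).

Lemma raised_of_gap_gap_bead (f : nat -> bool) M :
  (forall r, f r -> r < M) ->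
  (forall s1 s2 r, s1 < s2 -> s2 < r -> ~~ f s1 -> ~~ f s2 -> ~~ f r) ->
  exists2 k, k <= \sum_(r < M) f r & f =1 raised (\sum_(r < M) f r) k.
Proof.
move=> supp H.
have fN r : M <= r -> ~~ f r by move=> Mr; apply/negP => /supp; lia.
(* [s] and [t] are the first two gaps; all rows below [t] except [s] have beads, and no others. The
   distance [t.-1 - s] is 0 when the gaps are adjacent. *)
have : exists s, ~~ f s by exists M; exact: fN.
case/ex_minnP => s fs mins.
have : exists t, (s < t) && ~~ f t.
  by exists (maxn s.+1 M); rewrite leq_max leqnn fN // leq_max leqnn orbT.
case/ex_minnP => t /andP[st ft] mint.
have fE r : f r = (r < t) && (r != s).
  have [->|rs] := eqVneq r s; first by rewrite andbF (negPf fs).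
  rewrite andbT; have [rt|tr] := ltnP r t.
    apply/negPn/negP => fr; have sr : s <= r by apply: mins.
    have : t <= r by apply: mint; rewrite fr andbT; lia.
    by rewrite leqNgt rt.
  apply/negbTE; move: tr; rewrite leq_eqVlt => /orP[/eqP <- //|tr]; exact: (H s t).
have -> : \sum_(r < M) f r = t.-1; last first.
  exists (t.-1 - s); first by lia.
  by move=> r; rewrite fE /raised; lia.
have tM : t <= M.+1.
  apply: leq_trans (mint (maxn s.+1 M) _) _; first by rewrite leq_max leqnn fN ?leq_maxr.
  by rewrite geq_max; have := mins M (fN M (leqnn M)); lia.
have := sum_D1_bool M.+1 s (fun r => r < t) (fun=> 1).
have sM : s < M.+1 by lia.
move=> /(_ sM); rewrite st muln1.
under eq_bigr do rewrite mul1n.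
under [in X in _ = _ + X]eq_bigr do rewrite mul1n -fE.
rewrite [in RHS]big_ord_recr /= (negPf (fN M (leqnn M))) addn0.
have := sum_bool_interval (fun=> true) M.+1 t tM; rewrite /= => ->.
by rewrite sum_nat_const card_ord muln1 => ->.
Qed.

(** The occupied rows are [0 .. n] without [n - k], and ['C(n.+1, 2) - (n - k) = 'C(n, 2) + k]. *)
Lemma raised_sums M n k : k <= n -> n < M ->
  \sum_(r < M) raised n k r = n /\ \sum_(r < M) r * raised n k r = 'C(n, 2) + k.
Proof.
move=> kn nM.
have nkM : n - k < M by lia.
have fE r : raised n k r = ((r < n.+1) && (r != n - k)) by rewrite /raised; lia.
have D1 := sum_D1_bool M (n - k) (fun r => r < n.+1) (fun=> 1) nkM.
have D2 := sum_D1_bool M (n - k) (fun r => r < n.+1) id nkM.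
have I1 : \sum_(r < M) (r < n.+1) = n.+1.
  have := sum_bool_interval (fun=> true) M n.+1 nM; rewrite /= => ->.
  by rewrite sum_nat_const card_ord muln1.
have I2 : \sum_(r < M) r * (r < n.+1) = 'C(n.+1, 2).
  rewrite -bin2_sum big_mkord (big_ord_widen M (fun r => r) nM) [RHS]big_mkcond /=.
  by apply: eq_bigr => r _; case: (r < n.+1); rewrite ?muln1 ?muln0.
move: D1 D2; rewrite I2 ltnS leq_subr muln1 /=.
under eq_bigr do rewrite mul1n.
under [in X in _ = _ + X]eq_bigr do rewrite mul1n -fE.
under [in X in _ -> _ = _ + X -> _]eq_bigr do rewrite -fE.
rewrite I1 muln1 add1n => -[<-] D2; split=> //.
move: D2; rewrite binS bin1; lia.
Qed.

Lemma sum_multiples (d m : nat) (F : nat -> nat) : 0 < d ->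
  \sum_(j < m.+1) (if (0 < j) && (d %| j) then F (j %/ d).-1 else 0)
  = \sum_(i < m %/ d) F i.
Proof.
move=> d0; elim: m => [|m IH]; first by rewrite div0n big_ord0 big_ord_recr big_ord0.
rewrite big_ord_recr /= IH divnS //; case: (d %| m.+1); last by rewrite addn0.
by rewrite add1n big_ord_recr.
Qed.

Lemma sum_nth_sumn (t : seq nat) m : size t = m -> \sum_(i < m) nth 0 t i = sumn t.
Proof. by move=> <-; rewrite sumnE (big_nth 0) big_mkord. Qed.

(* The distances by which the runners [d, 2 d, ...] are raised. *)
Definition raise_of (d : nat) (t : seq nat) (j : nat) : nat :=
  if (0 < j) && (d %| j) then nth 0 t (j %/ d).-1 else 0.

Lemma raised_bead_block (d e M w : nat) (nn : nat -> nat) (t : seq nat)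
    (P : nat -> bool) : 1 < d -> 1 < e ->
  (forall i j, i < j -> nn i + (2 * w + 2) <= nn j) -> w <= nn 0 ->
  (forall j, j < e -> nn j + w < M) ->
  size t = (e - 1) %/ d -> sumn t = w ->
  (forall r j, j < e -> P (r * e + j) = raised (nn j) (raise_of d t j) r) ->
  bead_block d e M w (mkseq nn e) P.
Proof.
move=> hd he sp w0 nM st tw PE.
have e0 : 0 < e by lia.
have wn j : w <= nn j by case: j => // j; have := sp 0 j.+1 isT; lia.
have kw : \sum_(j < e) raise_of d t j = w.
  have -> : e = (e - 1).+1 by lia.
  rewrite (sum_multiples d (e - 1) (nth 0 t)) ?(ltnW hd) //.
  by rewrite sum_nth_sumn.
have kle j : j < e -> raise_of d t j <= w.
  by move=> je; rewrite -[X in _ <= X]kw (bigD1 (Ordinal je)) //= leq_addr.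
have sums j : j < e -> runner_count M e P j = nn j /\
    runner_sum M e P j = 'C(nn j, 2) + raise_of d t j.
  move=> je.
  have [|| c1 c2] := raised_sums M (nn j) (raise_of d t j).
  - by apply: leq_trans (kle j je) (wn j).
  - by have := nM j je; lia.
  by split; [rewrite -[RHS]c1|rewrite -[RHS]c2]; apply: eq_bigr => r _; rewrite PE.
have sep : separated e w nn P.
  split=> // j je; have kj := kle j je; have wj := wn j.
  by split=> r; rewrite PE // /raised; lia.
have bal : balanced_beads d e P.
  move=> j r s je sr Pr Ps; have [Hb Hg] := proj2 sep j je.
  have s1 := Hg s Ps; have r1 := Hb r Pr.
  move: (Pr) (Ps); rewrite !PE // /raised => Pr' Ps'.
  have kpos : raise_of d t j != 0 by lia.
  have dj : d %| j by move: kpos; rewrite /raise_of; case: (d %| j); rewrite ?andbF.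
  have /eqP j0 : (j%:R == 0 :> 'Z_d)%R by rewrite Zd_nat_eq0.
  rewrite (separated_gaps e w nn P j s.+1 r) //; [|lia|lia|].
    rewrite (separated_gapsS e w nn) // ?(negPf Ps); last by lia.
    by rewrite !natrD natrM j0 mulr0 !addr0.
  by move=> u ur; rewrite PE // /raised; lia.
split=> //.
- move=> x; rewrite (divn_eq x e) PE ?ltn_mod // /raised => /andP[xn _].
  have je : x %% e < e by rewrite ltn_mod.
  have : (x %/ e).+1 * e <= M * e by rewrite leq_mul2r; have := nM _ je; lia.
  by rewrite mulSn; lia.
- by move=> j je; rewrite nth_mkseq //; have [] := sums j je.
- rewrite (big_nth 0) size_mkseq big_mkord addnC -kw -big_split; apply: eq_bigr => j _ /=.
  by rewrite nth_mkseq //; have [] := sums j (ltn_ord j).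
(* The next gap is one row up on the same runner, or else runner [j] is raised, so [j > 0] and
   runner 0 has a gap in row [s.+1]. *)
- move=> c; rewrite (divn_eq c e); have : c %% e < e by rewrite ltn_mod.
  move: (c %/ e) (c %% e) => s j je Ps.
  have [Ps1|Ps1] := boolP (P (s.+1 * e + j)); last first.
    by exists (s.+1 * e + j) => //; rewrite mulSn; lia.
  have /andP[_ j0] : (d %| j) && (0 < j).
    have : raise_of d t j != 0 by move: Ps Ps1; rewrite !PE // /raised; lia.
    by rewrite andbC /raise_of; case: (_ && _).
  exists (s.+1 * e + 0); first by rewrite mulSn; lia.
  have [_ Hg] := proj2 sep j je; have [Hb _] := proj2 sep 0 e0.
  by apply/negP => /Hb; have := Hg _ Ps; have := sp 0 j j0; lia.
Qed.

Lemma bead_block_raised (d e M w : nat) (nn : nat -> nat) (P : nat -> bool) :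
  1 < d -> 1 < e ->
  (forall i j, i < j -> nn i + (2 * w + 2) <= nn j) -> w <= nn 0 ->
  (forall j, j < e -> nn j + w < M) ->
  bead_block d e M w (mkseq nn e) P ->
  exists t, [/\ size t = (e - 1) %/ d, sumn t = w &
    forall r j, j < e -> P (r * e + j) = raised (nn j) (raise_of d t j) r].
Proof.
move=> hd he sp w0 nM BP; have [sP cP wP bP rP] := BP.
have e0 : 0 < e by lia.
have d0 : 0 < d := ltnW hd.
have e1 : (e - 1).+1 = e by lia.
have le_e1 j : j < e -> j <= e - 1 by lia.
have en : e = size (mkseq nn e) by rewrite size_mkseq.
have wn j : w <= nn j by case: j => // j; have := sp 0 j.+1 isT; lia.
have sep : separated e w nn P.
  split=> // j je; split=> r Pr.
    by have := bead_block_bead d e M w _ P r j en BP je Pr; rewrite nth_mkseq.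
  by have := bead_block_gap d e M w _ P r j en BP je Pr; rewrite nth_mkseq.
have supp j : j < e -> forall r, P (r * e + j) -> r < M.
  move=> je r Pr; have [Hb _] := proj2 sep j je; have := Hb r Pr; have := nM j je; lia.
pose k j := runner_sum M e P j - 'C(nn j, 2).
have shape j : j < e -> k j <= nn j /\ (forall r, P (r * e + j) = raised (nn j) (k j) r)
    /\ runner_sum M e P j = 'C(nn j, 2) + k j.
  move=> je; have := raised_of_gap_gap_bead (fun r => P (r * e + j)) M (supp j je).
  rewrite -/(runner_count M e P j) cP // nth_mkseq //.
  case=> [s1 s2 r s12 s2r P1 P2|l ln fl].
    exact: (separated_gap_gap_bead d e w nn P j s1 s2 r).
  have [|_ S] := raised_sums M (nn j) l ln; first by have := nM j je; lia.
  have rs : runner_sum M e P j = 'C(nn j, 2) + l.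
    by rewrite -S; apply: eq_bigr => r _; rewrite fl.
  have -> : k j = l by rewrite /k rs addKn.
  by split=> //; split.
(* A nonzero excess puts the bead in row [nn j] above the gap in row [nn j - k j], which restricts
   [j]. *)
have k0 j : j < e -> ~~ ((0 < j) && (d %| j)) -> k j = 0.
  move=> je; apply: contraNeq => kj.
  have [kn [PE _]] := shape j je; rewrite andbC.
  apply: (separated_gap_bead d e w nn P j (nn j - k j) (nn j)) => //;
    rewrite ?PE /raised; lia.
pose t := mkseq (fun i => k (d * i.+1)) ((e - 1) %/ d).
have tk j : j < e -> raise_of d t j = k j.
  move=> je; rewrite /raise_of; case: ifPn => [/andP[j0 dj]|/(k0 j je)//].
  have jd : 0 < j %/ d by rewrite divn_gt0 // dvdn_leq.
  rewrite nth_mkseq; last first.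
    by rewrite prednK //; apply/leq_div2r/le_e1.
  by rewrite prednK // mulnC divnK.
exists t; split; first by rewrite size_mkseq.
- rewrite -(sum_nth_sumn t ((e - 1) %/ d)) ?size_mkseq //.
  rewrite -(sum_multiples d (e - 1) (nth 0 t)) // e1.
  rewrite (eq_bigr (fun j : 'I_e => k j)); last by move=> j _; exact: tk.
  have E : \sum_(j < e) runner_sum M e P j = \sum_(j < e) k j + \sum_(j < e) 'C(nn j, 2).
    rewrite -big_split; apply: eq_bigr => j _ /=; rewrite addnC.
    by have [_ []] := shape j (ltn_ord j).
  have EC : \sum_(a <- mkseq nn e) 'C(a, 2) = \sum_(j < e) 'C(nn j, 2).
    by rewrite (big_nth 0) size_mkseq big_mkord; apply: eq_bigr => j _; rewrite nth_mkseq.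
  by move: wP; rewrite E EC => /addIn.
- by move=> r j je; rewrite tk //; have [_ []] := shape j je.
Qed.

Lemma card_compositions (m w : nat) :
  [set t : seq nat | size t = m /\ sumn t = w] #= `I_('C(w + m - 1, w)).
Proof.
(* Without summands only [w = 0] has a solution, the empty list; the truncated subtraction gives 1
   for [w = 0] and 0 otherwise. *)
case: m => [|m].
  rewrite addn0; case: w => [|w].
    rewrite bin0; apply: (card_eq_rel _ _ _ _ (fun _ _ => True)).
    - by move=> t _; exists 0.
    - by move=> i _; exists [::].
    - by move=> t t' i [/size0nil -> _] [/size0nil -> _].
    - by move=> t [|i] [|i'].
  rewrite subSS subn0 bin_small //.
  by apply: (card_eq_rel _ _ _ _ (fun _ _ => False)) => // t [/size0nil ->].
have -> : 'C(w + m.+1 - 1, w) = #|[set t : m.+1.-tuple 'I_w.+1 | \sum_(i <- t) i == w]%SET|.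
  by rewrite card_ord_partitions addnS subSS subn0 addnC -bin_sub ?leq_addl // addnK.
set A := [set t | _]%SET.
pose S (t : seq nat) (i : nat) := exists2 u : m.+1.-tuple 'I_w.+1,
  u \in A /\ t = map val u & i = index u (enum A).
have sumE (u : m.+1.-tuple 'I_w.+1) : \sum_(i <- u) i = sumn (map val u).
  by rewrite sumnE big_map.
apply: (card_eq_rel _ _ _ _ S).
- move=> t [st tw].
  have tle x : x \in t -> x < w.+1.
    by move=> xt; rewrite ltnS -tw sumnE (big_rem x) //= leq_addr.
  have tE : map val (map (inord : nat -> 'I_w.+1) t) = t.
    rewrite -map_comp -[RHS]map_id; apply/eq_in_map => x xt /=.
    by rewrite inordK // tle.
  have su : size (map (inord : nat -> 'I_w.+1) t) == m.+1 by rewrite size_map st.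
  have uA : Tuple su \in A by rewrite inE sumE /= tE tw.
  exists (index (Tuple su) (enum A)); last by exists (Tuple su).
  by rewrite /= cardE index_mem mem_enum.
- move=> i /= iA; have u0 : m.+1.-tuple 'I_w.+1 := nseq_tuple m.+1 ord0.
  rewrite cardE in iA.
  have uA : nth u0 (enum A) i \in A by rewrite -mem_enum mem_nth.
  exists (map val (nth u0 (enum A) i)).
    rewrite size_map size_tuple -sumE; split=> //.
    by move: uA; rewrite inE => /eqP.
  by exists (nth u0 (enum A) i); rewrite // index_uniq // enum_uniq.
- move=> t t' i _ _ [u [uA ->] ->] [u' [u'A ->] E].
  congr (map val _); congr tval.
  by rewrite -(nth_index u (s := enum A) (x := u)) ?mem_enum // E nth_index ?mem_enum.
- move=> t i i' _ _ [u [_ tu] ->] [u' [_ tu'] ->]; congr index.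
  by apply: val_inj; apply: (inj_map val_inj); rewrite -tu -tu'.
Qed.

Lemma card_bead_block_separated (d e M w : nat) (nn : nat -> nat) :
  1 < d -> 1 < e ->
  (forall i j, i < j -> nn i + (2 * w + 2) <= nn j) -> w <= nn 0 ->
  (forall j, j < e -> nn j + w < M) ->
  bead_block d e M w (mkseq nn e) #= `I_('C(w + (e - 1) %/ d - 1, w)).
Proof.
move=> hd he sp w0 nM; have e0 : 0 < e by lia.
have le_e1 k : k <= e - 1 -> k < e by lia.
have wn j : w <= nn j by case: j => // j; have := sp 0 j.+1 isT; lia.
apply: card_eq_trans _ (card_compositions _ _).
apply: (card_eq_rel _ _ _ _ (fun P t => forall r j, j < e ->
  P (r * e + j) = raised (nn j) (raise_of d t j) r)).
- move=> P BP.
  have [t [st tw PE]] := bead_block_raised d e M w nn P hd he sp w0 nM BP.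
  by exists t.
- move=> t [st tw]; exists (fun x => raised (nn (x %% e)) (raise_of d t (x %% e)) (x %/ e)).
    apply: (raised_bead_block d e M w nn t) => // r j je.
    by rewrite divn_pos // modn_pos.
  by move=> r j je; rewrite divn_pos // modn_pos.
- move=> P P' t [sP _ _ _ _] [sP' _ _ _ _] PE PE'.
  by apply: (eq_pos_lt e M) => // r j _ je; rewrite PE ?PE'.
(* Entry [i] is recovered from runner [d * i.+1]: the gap in row [nn j - nth 0 t i] must also be the
   gap prescribed by [t']. *)
- move=> P t t' [st tw] [st' tw'] PE PE'.
  apply: (@eq_from_nth _ 0); first by rewrite st st'.
  rewrite st => i im; pose j := d * i.+1.
  have je : j < e.
    by apply: le_e1; rewrite /j mulnC -leq_divRL // ltnW.
  have E u : raise_of d u j = nth 0 u i.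
    by rewrite /raise_of /j dvdn_mulr // muln_gt0 mulKn ?(ltnW hd).
  have le u : sumn u = w -> size u = (e - 1) %/ d -> nth 0 u i <= w.
    by move=> <- su; rewrite -(sum_nth_sumn u _ su) (bigD1 (Ordinal im)) //= leq_addr.
  have := PE (nn j - nth 0 t i) j je; rewrite PE' // !E /raised.
  have := le _ tw st; have := wn j.
  move: (nth 0 t i) (nth 0 t' i) (nn j) => x y z; clear; lia.
Qed.

(** * Partitions as bead configurations *)

(** This is the beta-number of the part with 0-based index [j], increased by [K]; the subtraction is
    exact for [j < K]. *)
Definition bead_pos (s : seq nat) (K j : nat) : nat := nth 0 s j + (K - j.+1).

(* Position [x] stands for the element [x - K] of the beta-set. When
   [size s <= K], all integers below [-K] belong to it, and they are left out. *)
Definition beads (s : seq nat) (K : nat) : nat -> bool :=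
  fun x => x \in mkseq (bead_pos s K) K.

Lemma beadsP (s : seq nat) (K x : nat) :
  reflect (exists2 j, j < K & x = bead_pos s K j) (beads s K x).
Proof.
apply: (iffP mapP) => -[j]; first by rewrite mem_iota => jK ->; exists j.
by move=> jK ->; exists j; rewrite ?mem_iota.
Qed.

Lemma partition_nth (s : seq nat) i j : is_partition s -> i <= j -> nth 0 s j <= nth 0 s i.
Proof.
move=> /andP[srt _] ij; have [js|sj] := ltnP j (size s); last by rewrite (nth_default _ sj).
have gt : transitive geq by move=> a b c /= ab bc; exact: leq_trans bc ab.
by apply: (sorted_leq_nth gt leqnn 0 srt); rewrite ?inE //; apply: leq_ltn_trans ij js.
Qed.

Lemma partition_nth_gt0 (s : seq nat) j : is_partition s -> (0 < nth 0 s j) = (j < size s).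
Proof.
move=> /andP[_ s0]; have [js|sj] := ltnP j (size s); last by rewrite nth_default.
by rewrite lt0n; apply: contra s0 => /eqP <-; exact: mem_nth.
Qed.

Lemma bead_pos_lt (s : seq nat) K i j : is_partition s -> j < K ->
  (bead_pos s K j < bead_pos s K i) = (i < j).
Proof.
move=> sp jK; rewrite /bead_pos; have [ij|ji] := ltnP i j.
  by have := partition_nth s i j sp (ltnW ij); lia.
by have := partition_nth s j i sp ji; lia.
Qed.

Lemma sorted_bead_pos (s : seq nat) K : is_partition s ->
  sorted gtn (mkseq (bead_pos s K) K).
Proof.
move=> sp; apply: (@path_sorted _ _ (K + nth 0 s 0)).
apply/(pathP 0) => -[|i]; rewrite size_mkseq => iK.
  by rewrite /= nth_mkseq // /bead_pos; lia.
have H : bead_pos s K i.+1 < bead_pos s K i by rewrite bead_pos_lt.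
by rewrite /= !nth_mkseq // ltnW.
Qed.

Lemma beads_inj (s t : seq nat) K : is_partition s -> is_partition t ->
  size s <= K -> size t <= K -> beads s K = beads t K -> s = t.
Proof.
move=> sp tp sK tK E.
have gt : transitive gtn by move=> a b c /= ab bc; exact: ltn_trans bc ab.
have irr : irreflexive gtn by move=> a /=; rewrite ltnn.
have EL := irr_sorted_eq gt irr (sorted_bead_pos s K sp) (sorted_bead_pos t K tp)
  (fun x => congr1 (fun f => f x) E).
have nE j : nth 0 s j = nth 0 t j.
  have [jK|Kj] := ltnP j K; last by rewrite !nth_default // (leq_trans _ Kj).
  have := congr1 (fun l => nth 0 l j) EL; rewrite /= !nth_mkseq // /bead_pos.
  exact: addIn.
have sE : size s = size t.
  apply/eqP; rewrite eqn_leq; apply/andP; split; rewrite leqNgt.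
    by rewrite -(partition_nth_gt0 s _ sp) nE partition_nth_gt0 // ltnn.
  by rewrite -(partition_nth_gt0 t _ tp) -nE partition_nth_gt0 // ltnn.
exact: (@eq_from_nth _ 0).
Qed.

Lemma beads_onto (P : nat -> bool) N K :
  (forall x, P x -> x < N) -> \sum_(x < N) P x = K ->
  exists s, [/\ is_partition s, size s <= K & beads s K = P].
Proof.
elim: K P => [|K IH] P sP cP.
  exists [::]; split=> //; apply/funext => x; rewrite /beads /=; apply/esym/negbTE/negP => Px.
  by move/eqP: cP; rewrite sum_nat_eq0 => /forallP /(_ (Ordinal (sP x Px))); rewrite /= Px.
have [b Pb maxb] : exists2 b, P b & forall x, P x -> x <= b.
  have exP : exists x, P x.
    apply: contra_eqP cP => /forallNP noP; rewrite big1 // => x _.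
    by case: (boolP (P x)) => // /noP.
  have ubP x : P x -> x <= N by move=> /sP /ltnW.
  by case: (ex_maxnP exP ubP) => b Pb maxb; exists b.
have := sum_D1_bool N b P (fun=> 1) (sP b Pb).
under eq_bigr do rewrite mul1n; rewrite cP Pb muln1 add1n => -[cQ].
have [||s [sp sK sE]] := IH (fun x => P x && (x != b)).
- by move=> x /andP[/sP].
- by rewrite cQ; apply: eq_bigr => x _; rewrite mul1n.
have pos j : j < K -> P (bead_pos s K j) && (bead_pos s K j != b).
  by move=> jK; rewrite -[_ && _]/((fun x => P x && (x != b)) _) -sE; apply/beadsP; exists j.
have top j : j < K -> bead_pos s K j < b.
  by move=> /pos/andP[/maxb]; rewrite leq_eqVlt => /orP[->|].
have Kb : nth 0 s 0 + K <= b.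
  case: (posnP K) => [K0|K0]; last by have := top 0 K0; rewrite /bead_pos; lia.
  by move: sK; rewrite K0 leqn0 => /nilP ->.
have [t [tp tK t0 tS]] : exists t, [/\ is_partition t, size t <= K.+1,
    nth 0 t 0 = b - K & forall j, nth 0 t j.+1 = nth 0 s j].
  case: (posnP (b - K)) => [bK|bK].
    exists [::]; split=> // j; rewrite nth_nil; apply/esym/eqP; rewrite -leqn0.
    by apply: leq_trans (partition_nth s 0 j sp _) _ => //; lia.
  exists (b - K :: s); split=> //.
  move: sp => /andP[srt s0]; rewrite /is_partition inE negb_or s0 /=.
  have -> : 0 != b - K by lia.
  by rewrite andbT; case: s srt Kb {sK sE pos top s0} => //= a s -> /=; lia.
exists t; split=> //; apply/funext => x; apply/beadsP/idP.
  case=> -[|j] jK ->; first by rewrite /bead_pos t0 (_ : _ + _ = b) //; lia.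
  by rewrite /bead_pos tS subSS; have /andP[] := pos j jK.
move=> Px; have [->|xb] := eqVneq x b.
  by exists 0; rewrite // /bead_pos t0; lia.
have : beads s K x by rewrite sE Px.
by case/beadsP => j jK ->; exists j.+1; rewrite // /bead_pos tS subSS.
Qed.

Lemma gapsD_beads (P : nat -> bool) x : gaps P x + \sum_(y < x) P y = x.
Proof.
elim: x => [|x IH]; first by rewrite big_ord0.
by rewrite big_ord_recr /= addnACA IH; case: (P x); rewrite addn1.
Qed.

Lemma sum_beads (s : seq nat) K N (g : nat -> nat) : is_partition s ->
  \sum_(x < N) g x * beads s K x =
  \sum_(j < K) g (bead_pos s K j) * (bead_pos s K j < N).
Proof.
move=> sp; transitivity (\sum_(x < N) \sum_(j < K) g x * (bead_pos s K j == x)).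
  apply: eq_bigr => x _; rewrite -big_distrr /=; congr (_ * _).
  case: (beadsP s K x) => [[j jK xE]|nob].
    rewrite (bigD1 (Ordinal jK)) //= -xE eqxx big1 // => i ij.
    apply/eqP; rewrite eqb0 xE; apply: contra ij => /eqP E; apply/eqP/val_inj => /=.
    have := bead_pos_lt s K i j sp jK; have := bead_pos_lt s K j i sp (ltn_ord i).
    by rewrite E ltnn; lia.
  by rewrite big1 // => j _; apply/eqP; rewrite eqb0; apply/eqP => E; apply: nob; exists j.
rewrite exchange_big; apply: eq_bigr => j _ /=.
have [jN|Nj] := ltnP (bead_pos s K j) N.
  rewrite (bigD1 (Ordinal jN)) //= eqxx big1 ?addn0 // => x xj.
  case: eqP => E; last by rewrite muln0.
  by case/eqP: xj; apply: val_inj.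
rewrite muln0 big1 // => x _; case: eqP => E; last by rewrite muln0.
by have := ltn_ord x; rewrite -E ltnNge Nj.
Qed.

Lemma sum_beads_lt (s : seq nat) K x : is_partition s ->
  \sum_(y < x) beads s K y = \sum_(j < K) (bead_pos s K j < x).
Proof.
move=> sp; have := sum_beads s K x (fun=> 1) sp.
by under eq_bigr do rewrite mul1n; under [in RHS]eq_bigr do rewrite mul1n.
Qed.

(** Exactly [K - j.+1] beads lie below this one, and all other lower positions are gaps. *)
Lemma gaps_bead_pos (s : seq nat) K j : is_partition s -> j < K ->
  gaps (beads s K) (bead_pos s K j) = nth 0 s j.
Proof.
move=> sp jK; have := gapsD_beads (beads s K) (bead_pos s K j).
rewrite sum_beads_lt // (eq_bigr (fun i : 'I_K => ~~ (i < j.+1) : nat)); last first.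
  by move=> i _; rewrite bead_pos_lt // -leqNgt.
have : \sum_(i < K) (i < j.+1) + \sum_(i < K) ~~ (i < j.+1) = K.
  rewrite -big_split /= -[RHS]card_ord -sum1_card; apply: eq_bigr => i _.
  by case: (i < j.+1).
have := sum_bool_interval (fun=> true) K j.+1 jK; rewrite /= => ->.
rewrite sum_nat_const card_ord muln1 /bead_pos; lia.
Qed.

Lemma gaps_mono (P : nat -> bool) x y : x <= y -> gaps P x <= gaps P y.
Proof. by move=> xy; rewrite -(subnKC xy) gapsD leq_addr. Qed.

Lemma gaps_onto (P : nat -> bool) x v : v < gaps P x ->
  exists2 c, c < x & ~~ P c /\ gaps P c = v.
Proof.
elim: x => //= x IH; case: (boolP (P x)) => Px /=.
  by rewrite addn0 => /IH[c cx H]; exists c; first exact: ltnW.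
rewrite addn1 ltnS leq_eqVlt => /orP[/eqP ->|/IH[c cx H]]; first by exists x.
by exists c; first exact: ltnW.
Qed.

(** Gaps index columns: a gap with [g] gaps below it stands for column [g.+1], and the beads above
    it for the rows that reach this column. *)
Lemma lt_bead_pos (s : seq nat) K c j : is_partition s -> j < K -> ~~ beads s K c ->
  (c < bead_pos s K j) = (gaps (beads s K) c < nth 0 s j).
Proof.
move=> sp jK nc; have gj := gaps_bead_pos s K j sp jK.
have [cb|bc] := ltnP c (bead_pos s K j).
  have := gaps_mono (beads s K) _ _ cb; rewrite gj gaps_right nc addn1 => ->.
  by [].
have := gaps_mono (beads s K) _ _ bc; rewrite gj; lia.
Qed.

Lemma count_gt_parts (s : seq nat) K c : is_partition s -> size s <= K ->
  ~~ beads s K c ->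
  count (fun x => gaps (beads s K) c < x) s + c = K + gaps (beads s K) c.
Proof.
move=> sp sK nc; set g := gaps _ c.
have -> : count (fun x => g < x) s = \sum_(j < K) (g < nth 0 s j).
  rewrite -sum1_count (big_nth 0) big_mkord [LHS]big_mkcond.
  rewrite (big_ord_widen K (fun j => if g < nth 0 s j then 1 else 0) sK).
  rewrite big_mkcond /=; apply: eq_bigr => j _.
  by case: ltnP => // sj; rewrite nth_default // ltn0; case: ifP.
have := gapsD_beads (beads s K) c; rewrite sum_beads_lt // -/g.
have : \sum_(j < K) (g < nth 0 s j) + \sum_(j < K) (bead_pos s K j < c) = K.
  rewrite -big_split /= -[RHS]card_ord -sum1_card; apply: eq_bigr => j _.
  rewrite -lt_bead_pos //; case: ltngtP => // E.
  by case/negP: nc; apply/beadsP; exists j.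
lia.
Qed.

Lemma Zd_natD1_eq (d a b : nat) : 1 < d -> b < a ->
  ((a%:R = b%:R + 1 :> 'Z_d)%R <-> d %| a - b.+1).
Proof.
move=> hd ba; rewrite -Zd_nat_eq0 // natrB // subr_eq0 natr1.
by split=> [->|/eqP].
Qed.

(** A node corresponds to a bead (its row) above a gap (its column). The hook length is the
    difference of the two positions, and the arm length is the number of gaps strictly between
    them. *)
Lemma balanced_beads_balanced (d e : nat) (la : intpartition) K : 1 < d -> 0 < e ->
  size la <= K -> balanced d e la <-> balanced_beads d e (beads la K).
Proof.
move=> hd e0 laK; have sp := partsP la; set P := beads la K.
have hookE j c : j < K -> ~~ P c -> c < bead_pos la K j ->
    hook la j.+1 (gaps P c).+1 = bead_pos la K j - c.
  move=> jK nc cj; rewrite /hook /arm /part /conj_part /=.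
  have := count_gt_parts la K c sp laK nc; rewrite -/P.
  move: (cj); rewrite lt_bead_pos // -/P => gj.
  have -> : count (fun x => gaps P c < x) la = count (leq (gaps P c).+1) la by [].
  have jc : j.+1 + c <= K + gaps P c.
    have := gapsD_beads P c; rewrite sum_beads_lt //.
    have : \sum_(i < K) (bead_pos la K i < c) <= \sum_(i < K) ~~ (i < j.+1).
      apply: leq_sum => i _; have [bc|//] := ltnP (bead_pos la K i) c.
      by have := bead_pos_lt la K j i sp (ltn_ord i); rewrite (ltn_trans bc cj) -leqNgt => <-.
    have : \sum_(i < K) (i < j.+1) + \sum_(i < K) ~~ (i < j.+1) = K.
      rewrite -big_split /= -[RHS]card_ord -sum1_card; apply: eq_bigr => i _.
      by case: (i < j.+1).
    have := sum_bool_interval (fun=> true) K j.+1 jK; rewrite /= => ->.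
    rewrite sum_nat_const card_ord muln1; lia.
  rewrite /bead_pos; lia.
rewrite balanced_beadsP //; split=> H.
  move=> b c cb bc /beadsP[j jK bE] nc; subst b.
  move: (cb); rewrite lt_bead_pos // -/P => gj.
  rewrite gaps_bead_pos //; apply/Zd_natD1_eq => //.
  have := H j.+1 (gaps P c).+1; rewrite hookE // /in_diagram /part /= gj andbT.
  rewrite -partition_nth_gt0 // (leq_ltn_trans _ gj) //; apply=> //.
  by rewrite -eqn_mod_dvd ?(ltnW cb) //; apply/eqP.
case=> // j [|v]; rewrite /in_diagram ?andbF // /arm /part /= => /andP[jl vj].
have jK := leq_trans jl laK.
have vg : v < gaps P (bead_pos la K j) by rewrite gaps_bead_pos.
have [c cj [nc gc]] := gaps_onto P _ v vg; rewrite -gc hookE // => ec.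
rewrite -(gaps_bead_pos la K j sp jK); apply/Zd_natD1_eq => //; first by rewrite -/P gc.
apply: H => //; last by apply/beadsP; exists j.
by apply/eqP; rewrite eqn_mod_dvd // ltnW.
Qed.

(** The multiplicity is the difference of two column lengths, read off at consecutive gaps. *)
Lemma count_mem_gaps (s : seq nat) K c c' : is_partition s -> size s <= K ->
  c < c' -> ~~ beads s K c -> ~~ beads s K c' ->
  (forall y, c < y < c' -> beads s K y) ->
  count_mem (gaps (beads s K) c).+1 s = c' - c.+1.
Proof.
move=> sp sK cc nc nc' bet; set P := beads s K in bet *.
have gc' : gaps P c' = (gaps P c).+1.
  by rewrite (gaps_window P c.+1 c') // gaps_right nc addn1.
have := count_gt_parts s K c sp sK nc; have := count_gt_parts s K c' sp sK nc'.
rewrite -/P gc'; move: (gaps P c) => g.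
have -> : count (fun x => g < x) s = count_mem g.+1 s + count (fun x => g.+1 < x) s.
  by elim: {sp sK bet nc nc' gc' P} s => //= a s ->; lia.
lia.
Qed.

Lemma regular_beads_e_regular (e : nat) (la : intpartition) K : 0 < e ->
  size la <= K -> e_regular e la <-> regular_beads e (beads la K).
Proof.
move=> e0 laK; have sp := partsP la; set P := beads la K.
have nextgap c : ~~ P c -> exists c', [/\ c < c', ~~ P c' & forall y, c < y < c' -> P y].
  move=> nc; have ex : exists c', (c < c') && ~~ P c'.
    exists (c + nth 0 la 0 + K).+1; rewrite ltnS -addnA leq_addr /=.
    apply/negP => /beadsP[j jK].
    by rewrite /bead_pos; have := partition_nth la 0 j sp isT; lia.
  case/ex_minnP: ex => c' /andP[cc nc'] minc'; exists c'; split=> // y /andP[cy yc].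
  by apply/negPn/negP => ny; have := minc' y; rewrite cy ny leqNgt yc => /(_ isT).
split=> H.
  move=> c nc; have [c' [cc nc' bet]] := nextgap c nc.
  exists c' => //; rewrite cc /= leqNgt; apply/negP => big.
  have cE := count_mem_gaps la K c c' sp laK cc nc nc' bet.
  have : count_mem (gaps P c).+1 la < e by apply: H; rewrite -has_pred1 has_count cE; lia.
  rewrite cE; lia.
move=> x xla; have x0 : 0 < x.
  by rewrite lt0n; apply: contraL xla => /eqP ->; case/andP: sp.
have jl : index x la < size la by rewrite index_mem.
have jK := leq_trans jl laK.
have : x.-1 < gaps P (bead_pos la K (index x la)).
  by rewrite gaps_bead_pos // nth_index //; lia.
case/gaps_onto => c _ [nc gc]; have [c' [cc nc' bet]] := nextgap c nc.
have := count_mem_gaps la K c c' sp laK cc nc nc' bet; rewrite -/P gc prednK // => ->.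
have [y /andP[cy ye] ny] := H c nc.
have : c' <= y by rewrite leqNgt; apply/negP => yc; case/negP: ny; apply: bet; rewrite cy.
lia.
Qed.

(** * Cores and weights *)

Definition beta_of_beads (K : nat) (P : nat -> bool) : set int :=
  [set b : int | (b < - K%:Z)%R \/ exists2 x : nat, P x & b = (x%:Z - K%:Z)%R].

Lemma beta_beads (la : intpartition) K : size la <= K ->
  beta la = beta_of_beads K (beads la K).
Proof.
move=> laK; apply/seteqP; split=> b /=.
  case=> -[|j] // _ ->; rewrite /part /=.
  have [jK|Kj] := ltnP j K; last by left; rewrite nth_default ?(leq_trans laK) //; lia.
  right; exists (bead_pos la K j); first by apply/beadsP; exists j.
  by rewrite /bead_pos; lia.
case=> [bK|[x /beadsP[j jK ->] ->]].
  exists `|b|%N; first by lia.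
  by rewrite /part nth_default ?(leq_trans laK) //; lia.
by exists j.+1 => //; rewrite /part /bead_pos /=; lia.
Qed.

Lemma beta_of_beads_nat K (P : nat -> bool) (x : nat) :
  beta_of_beads K P (x%:Z - K%:Z)%R <-> P x.
Proof.
split=> [[|[y Py E]]|Px]; [lia| |by right; exists x].
by have -> : x = y by lia.
Qed.

Lemma beta_of_beads_inj K (P Q : nat -> bool) :
  beta_of_beads K P = beta_of_beads K Q -> P = Q.
Proof.
move=> E; apply/funext => x; apply/idP/idP => /(beta_of_beads_nat K).
  by rewrite E => /beta_of_beads_nat.
by rewrite -E => /beta_of_beads_nat.
Qed.

Definition lower_bead (e : nat) (P : nat -> bool) (x y : nat) : bool :=
  (P y && (y != x)) || (y == x - e).

Lemma beta_of_lower_bead K e (P : nat -> bool) x : 0 < e -> e <= x -> P x ->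
  beta_of_beads K (lower_bead e P x) =
  (beta_of_beads K P `\ (x%:Z - K%:Z)%R) `|` [set (x%:Z - K%:Z - e%:Z)%R].
Proof.
move=> e0 ex Px; apply/seteqP; split=> b /=.
  case=> [bK|[y /orP[/andP[Py yx]|/eqP ->] ->]].
  - by left; split; [left|lia].
  - by left; split; [right; exists y|move=> /= E; case/eqP: yx; lia].
  - by right; rewrite /=; lia.
case=> [[[bK|[y Py ->]] nb]|->].
- by left.
- right; exists y => //; rewrite /lower_bead Py /=.
  by case: eqP => //= yx; case: nb; rewrite /= yx.
- by right; exists (x - e); rewrite /lower_bead ?eqxx ?orbT //; lia.
Qed.

(** All integers below [- K] are present, so none of them can move and no bead can move there: every
    step takes place among the recorded positions. *)
Lemma beta_step_beads K e (P : nat -> bool) Y : 0 < e -> beta_step e (beta_of_beads K P) Y <->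
  exists x, [/\ e <= x, P x, ~~ P (x - e) & Y = beta_of_beads K (lower_bead e P x)].
Proof.
move=> e0; split=> [[b [Xb nXb YE]]|[x [ex Px nPx ->]]].
  case: Xb => [bK|[x Px bE]]; first by case: nXb; left; lia.
  subst b; have ex : e <= x.
    by rewrite leqNgt; apply/negP => xe; apply: nXb; left; lia.
  exists x; split=> //; last by rewrite beta_of_lower_bead.
  apply/negP => Pxe; apply: nXb; right; exists (x - e) => //; lia.
exists (x%:Z - K%:Z)%R; split; [exact/beta_of_beads_nat| |exact: beta_of_lower_bead].
have -> : (x%:Z - K%:Z - e%:Z = (x - e)%N%:Z - K%:Z)%R by lia.
by move/beta_of_beads_nat; apply/negP.
Qed.

Lemma lower_bead_supp e (P : nat -> bool) x M : (forall y, P y -> y < M) -> P x ->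
  forall y, lower_bead e P x y -> y < M.
Proof.
move=> sP Px y /orP[/andP[/sP]//|/eqP ->]; have := sP x Px; lia.
Qed.

(** Both sides carry the added or removed row as a summand, which avoids subtraction; [g] is later
    constant for bead counts and the identity for row sums. *)
Lemma lower_bead_sum M e (P : nat -> bool) x (g : nat -> nat) j : 0 < e -> j < e -> e <= x ->
  P x -> ~~ P (x - e) -> x < M * e ->
  \sum_(r < M) g r * lower_bead e P x (r * e + j) + (if j == x %% e then g (x %/ e) else 0)
  = \sum_(r < M) g r * P (r * e + j) + (if j == x %% e then g (x %/ e).-1 else 0).
Proof.
move=> e0 je ex; rewrite (divn_eq x e); have : x %% e < e by rewrite ltn_mod.
have : 0 < x %/ e by rewrite divn_gt0.
move: (x %/ e) (x %% e) => r0 i {ex x} r00 ie.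
rewrite divn_pos // modn_pos //; case: r0 r00 => // r0 _ Px nPx xM /=.
have xe : r0.+1 * e + i - e = r0 * e + i by rewrite mulSn; lia.
rewrite /lower_bead xe in nPx *.
have posE r r' k k' : k < e -> k' < e ->
    (r * e + k == r' * e + k') = (r == r') && (k == k').
  move=> ke ke'; apply/eqP/andP => [E|[/eqP-> /eqP->]//].
  have := congr1 (divn^~ e) E; have := congr1 (modn^~ e) E.
  by rewrite /= !modn_pos // !divn_pos // => -> ->.
have r0M : r0.+1 < M.
  rewrite ltnNge; apply/negP => Mr; move: xM; rewrite ltnNge => /negP[].
  exact: leq_trans (leq_mul Mr (leqnn e)) (leq_addr _ _).
have [->|ji] := eqVneq j i; last first.
  rewrite !addn0; apply: eq_bigr => r _; rewrite !posE // (negPf ji) !andbF andbT.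
  by rewrite orbF.
have D r1 : r1 < M -> \sum_(r < M) g r * (val r == r1) = g r1.
  move=> r1M; rewrite (bigD1 (Ordinal r1M)) //= eqxx muln1 big1 ?addn0 // => r rr.
  by case: eqP => E; rewrite ?muln0 //; case/eqP: rr; apply: val_inj.
rewrite -(D r0.+1) // -(D r0 (ltnW r0M)) -!big_split; apply: eq_bigr => r _ /=.
rewrite -!mulnDr !posE // eqxx !andbT; congr (_ * _).
have [->|r1] := eqVneq (val r) r0; first by rewrite (negPf nPx) ltn_eqF.
by have [->|r2] := eqVneq (val r) r0.+1; rewrite ?Px //= andbT orbF.
Qed.

Lemma lower_bead_count M e (P : nat -> bool) x j : 0 < e -> j < e -> e <= x ->
  P x -> ~~ P (x - e) -> x < M * e ->
  runner_count M e (lower_bead e P x) j = runner_count M e P j.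
Proof.
move=> e0 je ex Px nPx xM.
have := lower_bead_sum M e P x (fun=> 1) j e0 je ex Px nPx xM.
under eq_bigr do rewrite mul1n; under [in X in _ = X + _]eq_bigr do rewrite mul1n.
exact: addIn.
Qed.

Lemma lower_bead_rows M e (P : nat -> bool) x : 0 < e -> e <= x ->
  P x -> ~~ P (x - e) -> x < M * e ->
  (\sum_(j < e) runner_sum M e (lower_bead e P x) j).+1 = \sum_(j < e) runner_sum M e P j.
Proof.
move=> e0 ex Px nPx xM.
have S j (je : j < e) := lower_bead_sum M e P x id j e0 je ex Px nPx xM.
have xe : x %% e < e by rewrite ltn_mod.
rewrite (bigD1 (Ordinal xe)) // [RHS](bigD1 (Ordinal xe)) //= -addSn; congr (_ + _).
  have := S (x %% e) xe; rewrite eqxx /runner_sum.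
  have : 0 < x %/ e by rewrite divn_gt0.
  move: (x %/ e) (bigop _ _ _) (bigop _ _ _) => [|r] // a b _ /=.
  by rewrite addnS -addSn => /addIn.
apply: eq_bigr => j jx; have := S j (ltn_ord j).
have -> : (val j == x %% e) = false.
  by apply/negbTE; apply: contra jx => /eqP E; apply/eqP/val_inj.
by rewrite !addn0.
Qed.

Definition core_beads (e : nat) (P : nat -> bool) : Prop :=
  forall x, e <= x -> P x -> P (x - e).

Lemma core_beads_runner M e (P : nat -> bool) j : 0 < e -> core_beads e P ->
  (forall x, P x -> x < M * e) -> j < e ->
  forall r, P (r * e + j) = (r < runner_count M e P j).
Proof.
move=> e0 cP sP je.
have step r : P (r.+1 * e + j) -> P (r * e + j).
  by move=> /cP; rewrite mulSn -addnA addKn leq_addr; apply.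
have PM r : M <= r -> ~~ P (r * e + j).
  move=> Mr; apply/negP => /sP; rewrite ltnNge => /negP[].
  exact: leq_trans (leq_mul Mr (leqnn e)) (leq_addr _ _).
have : exists s, ~~ P (s * e + j) by exists M; exact: PM.
case/ex_minnP => s ns mins.
have sM : s <= M by apply: mins; exact: PM.
have PE r : P (r * e + j) = (r < s).
  have [rs|sr] := ltnP r s.
    by apply/negPn/negP => /mins; rewrite leqNgt rs.
  apply/negbTE; rewrite -(subnKC sr); elim: (r - s) => [|k IH]; first by rewrite addn0.
  by rewrite addnS; apply: contra IH; exact: step.
suff -> : runner_count M e P j = s by [].
rewrite /runner_count; have := sum_bool_interval (fun=> true) M s sM.
rewrite /= sum_nat_const card_ord muln1 => <-.
by apply: eq_bigr => r _; rewrite PE.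
Qed.

Lemma core_beads_rows M e (P : nat -> bool) : 0 < e -> core_beads e P ->
  (forall x, P x -> x < M * e) -> (forall j, j < e -> runner_count M e P j < M) ->
  \sum_(j < e) runner_sum M e P j = \sum_(j < e) 'C(runner_count M e P j, 2).
Proof.
move=> e0 cP sP cM; apply: eq_bigr => j _.
have [_] := raised_sums M (runner_count M e P j) 0 (leq0n _) (cM j (ltn_ord j)).
rewrite addn0 => <-; apply: eq_bigr => r _.
by rewrite (core_beads_runner M e P j) // /raised addn0 ltn_neqAle andbC.
Qed.

(** Each lowering decreases the total row sum by 1 and keeps the runner counts, so lowering
    terminates, and the counts determine the final configuration. *)
Lemma steps_to_core K M e (P C : nat -> bool) : 0 < e -> core_beads e C ->
  (forall x, C x -> x < M * e) -> (forall x, P x -> x < M * e) ->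
  (forall j, j < e -> runner_count M e P j = runner_count M e C j) ->
  clos_refl_trans (set int) (beta_step e) (beta_of_beads K P) (beta_of_beads K C).
Proof.
move=> e0 cC sC; move: {2}(\sum_(j < e) _) (erefl (\sum_(j < e) runner_sum M e P j)) => v.
elim: v P => [|v IH] P vP sP cP.
all: have [cP'|] := pselect (core_beads e P); first
  (have -> : P = C by apply: (eq_pos_lt e M) => // r j _ je;
     rewrite (core_beads_runner M e P j) // (core_beads_runner M e C j) // cP);
  try exact: rt_refl.
all: move=> /existsNP[x] /not_implyP[ex] /not_implyP[Px] /negP nPx.
all: have := lower_bead_rows M e P x e0 ex Px nPx (sP x Px); rewrite vP // => -[vQ].
apply: rt_trans; first by apply: rt_step; apply/beta_step_beads => //; exists x; split.
apply: IH => //; first by apply: lower_bead_supp.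
by move=> j je; rewrite lower_bead_count ?cP // sP.
Qed.

(** Runner counts are invariant under steps; so a partition has the runner counts of its core. *)
Lemma steps_runner_count K M e (P : nat -> bool) (X Y : set int) : 0 < e ->
  clos_refl_trans (set int) (beta_step e) X Y ->
  X = beta_of_beads K P -> (forall x, P x -> x < M * e) ->
  exists Q, [/\ Y = beta_of_beads K Q, forall x, Q x -> x < M * e &
    forall j, j < e -> runner_count M e Q j = runner_count M e P j].
Proof.
move=> e0 XY; elim: XY P => {X Y} [X Y XY|X|X Y Z _ IH1 _ IH2] P XE sP.
- move: XY; rewrite XE beta_step_beads // => -[x [ex Px nPx ->]].
  exists (lower_bead e P x); split=> //; first exact: lower_bead_supp.
  by move=> j je; rewrite lower_bead_count // sP.
- by exists P.
- have [Q [YE sQ cQ]] := IH1 P XE sP; have [R [ZE sR cR]] := IH2 Q YE sQ.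
  by exists R; split=> // j je; rewrite cR ?cQ.
Qed.

(** * Sizes as sums of positions, and the passage from blocks to bead configurations *)

Lemma sum_positions (M e : nat) (F : nat -> nat) :
  \sum_(x < M * e) F x = \sum_(j < e) \sum_(r < M) F (r * e + j).
Proof.
rewrite exchange_big /=; elim: M => [|M IH]; first by rewrite mul0n !big_ord0.
rewrite big_ord_recr /= -IH mulSnr -!(big_mkord xpredT) /=.
rewrite (big_cat_nat _ (n := M * e)) ?leq_addr //=; congr (_ + _).
rewrite -{1}[M * e]add0n big_addn addKn big_mkord.
by apply: eq_bigr => i _; rewrite addnC.
Qed.

(** For fixed runner counts the sum of positions, and with it the size of the partition, depends
    only on the total row sum, with slope [e]. *)
Lemma sum_positions_runners (M e : nat) (P : nat -> bool) :
  \sum_(x < M * e) x * P x = e * (\sum_(j < e) runner_sum M e P j)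
    + \sum_(j < e) j * runner_count M e P j.
Proof.
rewrite (sum_positions M e (fun x => x * P x)) big_distrr -big_split.
apply: eq_bigr => j _; rewrite /runner_sum /runner_count !big_distrr -big_split.
by apply: eq_bigr => r _ /=; rewrite mulnDl; congr (_ + _); rewrite mulnAC mulnC.
Qed.

Lemma e_weight_eq e (la ga : intpartition) w : 0 < e ->
  e_weight e la ga = (w%:R)%R <-> psize la = psize ga + e * w.
Proof.
move=> e0; have e0' : (e%:R != 0 :> rat)%R by rewrite pnatr_eq0 -lt0n.
rewrite /e_weight; split=> [/(canRL (divfK e0'))|->].
  move/(canRL (subrK _)); rewrite -natrM -natrD => /eqP; rewrite eqr_nat => /eqP ->.
  by rewrite addnC mulnC.
by rewrite natrD addrAC subrr add0r natrM mulrC mulKf.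
Qed.

Lemma size_le_psize (la : intpartition) : size la <= psize la.
Proof.
case: la => s /=; rewrite /psize /= => /andP[_ s0].
elim: s s0 => //= a s IH; rewrite inE negb_or => /andP[a0 s0].
by have := IH s0; lia.
Qed.

Lemma beads_lt (la : intpartition) K x : beads la K x -> x < psize la + K.
Proof.
case/beadsP => j jK ->; rewrite /bead_pos.
have : nth 0 la j <= psize la.
  rewrite /psize sumnE; have [jl|lj] := ltnP j (size la); last by rewrite nth_default.
  by rewrite (big_rem (nth 0 la j)) ?mem_nth // leq_addr.
lia.
Qed.

Lemma sum_all_beads (la : intpartition) K N (g : nat -> nat) : psize la + K <= N ->
  \sum_(x < N) g x * beads la K x = \sum_(j < K) g (bead_pos la K j).
Proof.
move=> laN; rewrite (sum_beads la K N g (partsP la)); apply: eq_bigr => j _.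
rewrite (leq_trans _ laN) ?muln1 //; apply: beads_lt; apply/beadsP; by exists j.
Qed.

Lemma psize_beads (la : intpartition) K N : size la <= K -> psize la + K <= N ->
  \sum_(x < N) x * beads la K x = psize la + 'C(K, 2).
Proof.
move=> laK laN; rewrite (sum_all_beads la K N id laN) /bead_pos big_split /=.
congr (_ + _); last first.
  rewrite -bin2_sum -(big_mkord xpredT (fun j => K - j.+1)) big_nat_rev /= !big_mkord.
  by apply: eq_bigr => j _; have := ltn_ord j; lia.
rewrite /psize sumnE (big_nth 0) big_mkord (big_ord_widen K (nth 0 la) laK).
rewrite [RHS]big_mkcond; apply: eq_bigr => j _ /=.
by case: ltnP => // lj; rewrite nth_default.
Qed.

Lemma sum_runner_count_beads (la : intpartition) K M e : psize la + K <= M * e ->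
  \sum_(j < e) runner_count M e (beads la K) j = K.
Proof.
move=> laM; rewrite -(sum_positions M e (fun x => beads la K x)).
have := sum_all_beads la K (M * e) (fun=> 1) laM.
under eq_bigr do rewrite mul1n; move=> ->.
by rewrite sum_nat_const card_ord muln1.
Qed.

Lemma core_beads_core (ga : intpartition) e K : 0 < e -> size ga <= K ->
  is_core_of e ga ga -> core_beads e (beads ga K).
Proof.
move=> e0 gaK [_ term] x ex Px; apply: contrapT => /negP nPx; apply: term.
exists (beta_of_beads K (lower_bead e (beads ga K) x)).
by rewrite (beta_beads ga K gaK); apply/beta_step_beads => //; exists x; split.
Qed.

(** All partitions of the block have size [psize ga + e * w], so [K] beads represent each of them
    and they fit into [M] rows. The runner counts then encode the core and the total row sum encodes
    the weight. *)
Lemma card_block_beads (d e w K M : nat) (ga : intpartition) : 1 < d -> 1 < e ->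
  is_core_of e ga ga -> psize ga + e * w <= K -> psize ga + e * w + K <= M -> K < M ->
  [set la : intpartition |
    [/\ block e ga w la, balanced d e la & e_regular e la]]
  #= bead_block d e M w (mkseq (runner_count M e (beads ga K)) e).
Proof.
move=> hd he hga gK gM KM; have e0 : 0 < e := ltnW he.
have Me N : N <= M -> N <= M * e by move=> NM; apply: leq_trans NM (leq_pmulr _ e0).
have gaK : size ga <= K by have := size_le_psize ga; lia.
have coreG := core_beads_core ga e K e0 gaK hga.
have gaM : psize ga + K <= M * e by apply: Me; lia.
have supG x : beads ga K x -> x < M * e by move=> /beads_lt xl; apply: leq_trans xl gaM.
have cM j : j < e -> runner_count M e (beads ga K) j < M.
  move=> je; apply: leq_ltn_trans KM.
  rewrite -[X in _ <= X](sum_runner_count_beads ga K M e gaM).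
  by rewrite (bigD1 (Ordinal je)) //= leq_addr.
have rowsG := core_beads_rows M e _ e0 coreG supG cM.
have nE (F : nat -> nat) : \sum_(a <- mkseq (runner_count M e (beads ga K)) e) F a =
    \sum_(j < e) F (runner_count M e (beads ga K) j).
  by rewrite (big_nth 0) size_mkseq big_mkord; apply: eq_bigr => j _; rewrite nth_mkseq.
have weightE (la : intpartition) : size la <= K -> psize la + K <= M * e ->
    (forall j, j < e -> runner_count M e (beads la K) j = runner_count M e (beads ga K) j) ->
    psize la = psize ga + e * w <->
    \sum_(j < e) runner_sum M e (beads la K) j =
      w + \sum_(a <- mkseq (runner_count M e (beads ga K)) e) 'C(a, 2).
  move=> laK laM cE; rewrite (nE (fun a => 'C(a, 2))) -rowsG.
  have := psize_beads la K (M * e) laK laM; have := psize_beads ga K (M * e) gaK gaM.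
  rewrite !sum_positions_runners.
  have -> : \sum_(j < e) j * runner_count M e (beads la K) j =
      \sum_(j < e) j * runner_count M e (beads ga K) j.
    by apply: eq_bigr => j _; rewrite cE.
  move: (\sum_(j < e) runner_sum M e (beads la K) j)
    (\sum_(j < e) runner_sum M e (beads ga K) j).
  move: (\sum_(j < e) _) ('C(K, 2)) => X Y a b Eb Ea; split=> [E|E].
    have : e * a = e * (w + b) by rewrite mulnDr; lia.
    by move/eqP; rewrite eqn_pmul2l // => /eqP.
  by move: Ea; rewrite E mulnDr; lia.
have blockP (la : intpartition) : block e ga w la ->
    [/\ size la <= K, psize la + K <= M * e & psize la = psize ga + e * w].
  move=> [_ /(e_weight_eq _ _ _ _ e0) laE]; have := size_le_psize la.
  by split=> //; [lia | apply: Me; lia].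
apply: (card_eq_rel _ _ _ _ (fun (la : intpartition) P => beads la K = P)).
- move=> la [bla bal reg]; have [laK laM laE] := blockP la bla.
  exists (beads la K) => //.
  have supL x : beads la K x -> x < M * e by move=> /beads_lt xl; apply: leq_trans xl laM.
  have [[steps _] _] := bla.
  have [Q [QE sQ cQ]] := steps_runner_count K M e _ _ _ e0 steps (beta_beads la K laK) supL.
  move: QE; rewrite (beta_beads ga K gaK) => /beta_of_beads_inj QE; subst Q.
  split=> //.
  + by move=> j je; rewrite nth_mkseq // cQ.
  + by apply/weightE => // j je; rewrite cQ.
  + exact/balanced_beads_balanced.
  + exact/regular_beads_e_regular.
- move=> P [sP cP wP bP rP].
  have cP' j : j < e -> runner_count M e P j = runner_count M e (beads ga K) j.
    by move=> je; rewrite cP // nth_mkseq.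
  have sumP : \sum_(x < M * e) P x = K.
    rewrite (sum_positions M e (fun x => P x)).
    rewrite -[RHS](sum_runner_count_beads ga K M e gaM); apply: eq_bigr => j _; exact: cP'.
  have [s [sp sK sE]] := beads_onto P (M * e) K sP sumP.
  pose la := Partition sp; have laE : beads la K = P by [].
  exists la => //.
  have laP : psize la = psize ga + e * w.
    (* The size of [la] is not yet bounded, so positions are summed over a longer range; there are
       no beads from [M * e] on. *)
    have laM' : psize la + K <= M * e + psize la + K by lia.
    have sup2 x : beads la K x -> x < M * e by rewrite laE; exact: sP.
    have E : \sum_(x < M * e) x * beads la K x = psize la + 'C(K, 2).
      rewrite -(psize_beads la K (M * e + psize la + K) sK laM').
      rewrite (big_ord_widen (M * e + psize la + K) (fun x => x * beads la K x)); last by lia.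
      rewrite big_mkcond; apply: eq_bigr => x _ /=; case: ltnP => // xM.
      by rewrite (_ : beads la K x = false) ?muln0 //; apply/negbTE/negP => /sup2; lia.
    have := psize_beads ga K (M * e) gaK gaM; move: E; rewrite !sum_positions_runners.
    rewrite laE wP (nE (fun a => 'C(a, 2))) -rowsG.
    have -> : \sum_(j < e) j * runner_count M e P j =
      \sum_(j < e) j * runner_count M e (beads ga K) j.
      by apply: eq_bigr => j _; rewrite cP'.
    rewrite mulnDr; move: (\sum_(j < e) _) (\sum_(j < e) _) => X Y; lia.
  split.
  + split; last exact/e_weight_eq.
    split; last by have [_] := hga.
    rewrite (beta_beads la K sK) (beta_beads ga K gaK) laE.
    exact: (steps_to_core K M e).
  + by apply/(balanced_beads_balanced d e la K); rewrite ?laE.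
  + by apply/(regular_beads_e_regular e la K); rewrite ?laE.
- move=> la la' P [/blockP[laK _ _] _ _] [/blockP[laK' _ _] _ _] <- E.
  by apply: val_inj; apply: (beads_inj la la' K) => //; exact: partsP.
- by move=> la P P' _ _ -> ->.
Qed.

(* For w = 0 and (e - 1) %/ d = 0 the truncated subtraction gives 'C(0, 0) = 1,
   the value prescribed for the binomial coefficient (-1 choose 0). *)
Theorem theorem5p1 (d e w : nat) (hd : 1 < d) (he : 1 < e)
    (ga : intpartition) (hga : is_core_of e ga ga) :
  [set la : intpartition |
    [/\ block e ga w la, balanced d e la & e_regular e la]]
    #= `I_('C(w + (e - 1) %/ d - 1, w)).
Proof.
have e0 : 0 < e := ltnW he.
(* The summand [e * w.+1] provides more than [w] beads on each runner of the core. The targets [nn]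
   start at [K], hence dominate the counts of the core, and are spaced by [2 * w + 2]; [M] leaves
   room for all of them. *)
pose K := psize ga + e * w.+1.
pose nn j := K + j * (2 * w + 2).
pose M := psize ga + e * w + K + nn e + w.+1.
have gaK : size ga <= K by have := size_le_psize ga; rewrite /K; lia.
have KM : K < M by rewrite /M; lia.
have gaM : psize ga + K <= M * e.
  by apply: leq_trans (leq_pmulr M e0); rewrite /M; lia.
have hb : psize ga + e * w <= K by rewrite /K mulnS; lia.
have hM : psize ga + e * w + K <= M by rewrite /M; lia.
apply: card_eq_trans (card_block_beads d e w K M ga hd he hga hb hM KM) _.
have nnM j : j < e -> nn j + w < M.
  by move=> je; have : nn j <= nn e; [rewrite leq_add2l leq_mul2r ltnW ?orbT|rewrite /M; lia].
apply: card_eq_trans _ (card_bead_block_separated d e M w nn hd he _ _ nnM); last first.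
- by rewrite /nn /K mulnS; nia.
- by move=> i j ij; rewrite /nn; nia.
have cK j : j < e -> runner_count M e (beads ga K) j <= K.
  move=> je; rewrite -[X in _ <= X](sum_runner_count_beads ga K M e gaM).
  by rewrite (bigD1 (Ordinal je)) //= leq_addr.
have cw j : j < e -> w <= runner_count M e (beads ga K) j.
  move=> je.
  have supG x : beads ga K x -> x < M * e by move=> /beads_lt xl; apply: leq_trans xl gaM.
  apply: ltnW; rewrite -(core_beads_runner M e _ j e0 (core_beads_core ga e K e0 gaK hga)) //.
  (* The zero parts of [ga] fill at least the first [e * w.+1] positions, so row [w] is occupied on
     every runner. *)
  have wjK : w * e + j < e * w.+1 by rewrite mulnS mulnC; lia.
  apply/beadsP; exists (K - (w * e + j).+1); first by rewrite /K; lia.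
  rewrite /bead_pos nth_default ?add0n; first by rewrite /K; lia.
  by have := size_le_psize ga; rewrite /K; lia.
have := bead_block_raise d M w (mkseq (runner_count M e (beads ga K)) e) (mkseq nn e).
rewrite !size_mkseq; apply=> // j je; rewrite !nth_mkseq //.
- exact: cw.
- by apply: leq_trans (cK j je) _; rewrite /nn leq_addr.
- exact: nnM.
Qed.
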